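(* Let $\prec$ be an exposure order on $F$ and let $I\lneqq\mathcal{A}=K[F]$ be a proper right ideal. Suppose that $f$ is an exposure-extending element for $I$, and let $I'$ be the right ideal generated by $I\cup\{f\}$. Then $$B_{I',\prec}=B_{I,\prec}\cup\{f\}\quad\text{and}\quad B_{I',\prec}^{\mathrm{gr}}=B_{I,\prec}^{\mathrm{gr}}\cup\{f,s\},$$ where $s$ is the $I$-second of $f$.
   Context: $K$ is a field, $F$ is a free group with finite basis $S$ (elements are reduced words in $S\cup S^{-1}$; $e$ is the identity), and $\mathcal{A}=K[F]$. The support $\mathrm{supp}(f)$ of $f\in\mathcal{A}$ is the set of words with nonzero coefficient in $f$; $f$ is supported on $T\subseteq F$ if $\mathrm{supp}(f)\subseteq T$. $\mathrm{Sp}_K(T)$ is the $K$-span of $T$. ''Ideal'' means right ideal. An exposure order on $F$ is a well-order $\prec$ on $F$ such that $u\preceq v$ whenever $u$ is a prefix of $v$. For distinct subsets $A,B\subseteq F$: $A\prec_{\min}B$ if $\min(A\triangle B)\in A$ (a total order on subsets). For distinct finite subsets: $A\prec_{\max}B$ if $\max(A\triangle B)\in B$ (a well-order on finite subsets). For $0\ne f\in\mathcal{A}$, the head term $\mathrm{HT}(f)$ is the $\prec$-maximal word in $\mathrm{supp}(f)$; $f$ is monic if the coefficient of $\mathrm{HT}(f)$ in $f$ is $1$. For $f\in\mathcal{A}\setminus K$, the head term tail $\mathrm{HTT}(f)\in S\cup S^{-1}$ is the last letter of $\mathrm{HT}(f)$. A Schreier transversal for $I$ is a prefix-closed subset $T\subseteq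 F$ such that $\mathrm{Sp}_K(T)\cap I=\{0\}$ and every $I$-coset in $\mathcal{A}$ intersects $\mathrm{Sp}_K(T)$. The set of Schreier transversals for $I$ has a $\prec_{\min}$-minimum, denoted $T_I=T_{I,\prec}$. $\phi_I:\mathcal{A}\to\mathrm{Sp}_K(T_I)$ sends $f$ to the unique element of $f+I$ supported on $T_I$. For $f\in\mathcal{A}\setminus K$ supported on $T_I$, with $b=\mathrm{HTT}(f)$, the $I$-second of $f$ is the monic $K^\times$-multiple of $\phi_I(fb^{-1})$ (which is nonzero). Exposure process of $I$: define $f_\alpha\in I$ by transfinite recursion. Given $f_\beta$ for all $\beta<\alpha$, let $I_\alpha$ be the right ideal generated by $\{f_\beta:\beta<\alpha\}$. If $I_\alpha=I$, stop and set $\omega_I:=\alpha$. Otherwise let $f_\alpha$ be the unique monic element of $I$ whose support is $\prec_{\max}$-minimal among the monic elements of $I$ supported on $T_{I_\alpha}$ (it exists and is unique, and the process always stops). The exposure basis is $B_I=B_{I,\prec}=\{f_\alpha:\alpha<\omega_I\}$. For $I\neq\mathcal{A}$, the second $s_\alpha$ of $f_\alpha$ is the $I_\alpha$-second of $f_\alpha$, and the Gröbner basis of $I$ is $B_{I,\prec}^{\mathrm{gr}}=\{f_\alpha\}_{\alpha<\omega_I}\cup\{s_\alpha\}_{\alpha<\omega_I}$; by convention $B_{\mathcal{A},\prec}^{\mathrm{gr}}=\{e\}$. An element $f$ is exposure-extending for $I\lneqq\mathcal{A}$ (with respect to $\prec$) if $f\in\mathcal{A}\setminus K$ is monic and supported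 on $T_I$, $\mathrm{HT}(f)\succ\mathrm{HT}(f')$ for all $f'\in B_I$, and $\mathrm{HT}(s)\succ\mathrm{HT}(f)$, where $s$ is the $I$-second of $f$. *)

(* Defs.v *)
From HB Require Import structures.
From mathcomp Require Import all_boot all_order all_algebra.
From mathcomp Require Import finmap.
From mathcomp.multinomials Require Import monalg.
From mathcomp Require Import mathcomp_extra boolp classical_sets wochoice.

Set Implicit Arguments.
Unset Strict Implicit.
Unset Printing Implicit Defensive.

Import GRing.Theory.

Local Open Scope fset_scope.
Local Open Scope ring_scope.

(* Free groups: reduced words over S and its formal inverses. The letter       *)
(* (s, false) stands for the generator s, and (s, true) for its inverse.       *)
Notation letter S := (S * bool)%type.

Section Reduction.
Variable S : finType.
Implicit Types (x y : letter S) (u v w : seq (letter S)).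

Definition linv x : letter S := (x.1, ~~ x.2).

Definition reduced w : bool := sorted (fun x y => y != linv x) w.

Definition push x w : seq (letter S) :=
  if w is y :: w' then if y == linv x then w' else x :: w else [:: x].

(* the reduced form of u ++ v, when v is reduced *)
Definition wmul u v : seq (letter S) := foldr push v u.

Definition winv w : seq (letter S) := rev (map linv w).

Lemma linvK : involutive linv.
Proof. by case=> s b; rewrite /linv /= negbK. Qed.

Lemma linv_neq x : linv x != x.
Proof. by case: x => s b; rewrite xpair_eqE eqxx /=; case: b. Qed.

Lemma reduced_push x w : reduced w -> reduced (push x w).
Proof.
case: w => //= y w rw; case: ifPn => [_|nxy] /=; first exact: path_sorted rw.
by rewrite nxy.
Qed.

Lemma reduced_wmul u v : reduced v -> reduced (wmul u v).
Proof. by move=> rv; elim: u => //= x u; apply: reduced_push. Qed.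

Lemma reduced_winv w : reduced w -> reduced (winv w).
Proof.
rewrite /reduced /winv rev_sorted sorted_map; apply: sub_sorted => x y /=.
by rewrite linvK eq_sym.
Qed.

Lemma push_reduced x w : reduced (x :: w) -> push x w = x :: w.
Proof. by case: w => //= y w /andP[/negbTE-> _]. Qed.

Lemma pushK x w : reduced w -> push x (push (linv x) w) = w.
Proof.
case: w => [|y w] rw /=; first by rewrite eqxx.
rewrite linvK; case: ifPn => [/eqP yx|_]; first by rewrite -yx push_reduced.
by rewrite /= eqxx.
Qed.

Lemma wmul_push x u v : reduced v -> wmul (push x u) v = push x (wmul u v).
Proof.
move=> rv; case: u => //= y u; case: ifP => //= /eqP->.
by rewrite pushK //; apply: reduced_wmul.
Qed.

Lemma wmulA u v w : reduced w -> wmul u (wmul v w) = wmul (wmul u v) w.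
Proof. by move=> rw; elim: u => //= x u IHu; rewrite wmul_push // IHu. Qed.

Lemma wmulw0 w : reduced w -> wmul w [::] = w.
Proof.
elim: w => //= x w IHw rw.
by rewrite /wmul /= -/(wmul _ _) IHw ?push_reduced //; apply: path_sorted rw.
Qed.

Lemma winvK : involutive winv.
Proof. by move=> w; rewrite /winv map_rev revK mapK //; apply: linvK. Qed.

Lemma wmulwV w : reduced w -> wmul w (winv w) = [::].
Proof.
have H u v : reduced (rev u ++ v) -> wmul (winv (rev u)) (rev u ++ v) = v.
  rewrite /winv map_rev revK; elim: u v => //= x u IHu v.
  rewrite rev_cons cat_rcons => rv; rewrite IHu //=.
  by rewrite linvK eqxx.
move=> rw; have := H (rev (winv w)) [::].
by rewrite revK cats0 winvK => ->//; apply: reduced_winv.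
Qed.
End Reduction.

Record freegroup (S : finType) :=
  FreeGroup { fgword :> seq (letter S); _ : reduced fgword }.

HB.instance Definition _ (S : finType) := [isSub for @fgword S].
HB.instance Definition _ (S : finType) := [Choice of freegroup S by <:].

Section FreeGroup.
Variable S : finType.
Implicit Types u v w : freegroup S.

Definition fg_one : freegroup S := FreeGroup (erefl : reduced [::]).
Definition fg_mul u v : freegroup S := FreeGroup (reduced_wmul u (valP v)).
Definition fg_inv u : freegroup S := FreeGroup (reduced_winv (valP u)).

Lemma fg_mulA : associative fg_mul.
Proof. by move=> u v w; apply: val_inj; rewrite /= wmulA //; apply: valP. Qed.

Lemma fg_mul1 : left_id fg_one fg_mul.
Proof. by move=> u; apply: val_inj. Qed.

Lemma fg_mulr1 : right_id fg_one fg_mul.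
Proof. by move=> u; apply: val_inj; rewrite /= wmulw0 //; apply: valP. Qed.

Lemma fg_mulV : right_inverse fg_one fg_inv fg_mul.
Proof. by move=> u; apply: val_inj; rewrite /= wmulwV //; apply: valP. Qed.

Lemma fg_mulVl : left_inverse fg_one fg_inv fg_mul.
Proof.
move=> u; rewrite -[u in fg_mul _ u](_ : fg_inv (fg_inv u) = u) ?fg_mulV //.
by apply: val_inj; rewrite /= winvK.
Qed.

HB.instance Definition _ := isGroup.Build (freegroup S)
  fg_mulA fg_mul1 fg_mulr1 fg_mulVl fg_mulV.

Definition letter_elt (x : letter S) : freegroup S :=
  FreeGroup (erefl : reduced [:: x]).

Definition is_prefix u v : bool := prefix (fgword u) (fgword v).
End FreeGroup.

(* The group algebra K[G]. The library makes {malg K[G]} a ring only when G    *)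
(* is a monoid without nontrivial units, so the ring structure of K[G] is put  *)
(* on an alias of {malg K[G]}.                                                 *)
Definition grpalg (K : fieldType) (G : groupType) : Type := {malg K[G]}.

Section GroupAlgebra.
Variables (K : fieldType) (G : groupType).
Local Notation A := (grpalg K G).

HB.instance Definition _ := GRing.Lmodule.copy A {malg K[G]}.

Implicit Types (f : A) (g : G) (c : K).

Definition gaU g c : A := << c *g g >>.

Definition gacoef g f : K := mcoeff g (f : {malg K[G]}).

Definition gasupp f : {fset G} := msupp (f : {malg K[G]}).

Definition gamul f1 f2 : A :=
  \sum_(g1 <- gasupp f1) \sum_(g2 <- gasupp f2)
    gaU (g1 * g2)%g (gacoef g1 f1 * gacoef g2 f2).

Lemma gaP f1 f2 : (forall g, gacoef g f1 = gacoef g f2) <-> f1 = f2.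
Proof. exact: malgP. Qed.

Lemma gacoef_is_additive g : zmod_morphism (gacoef g).
Proof. by move=> f1 f2; rewrite /gacoef mcoeffB. Qed.

Lemma gaU_is_additive g : zmod_morphism (gaU g).
Proof. by move=> c1 c2; rewrite /gaU monalgUB. Qed.

HB.instance Definition _ g :=
  GRing.isZmodMorphism.Build A K (gacoef g) (gacoef_is_additive g).

HB.instance Definition _ g :=
  GRing.isZmodMorphism.Build K A (gaU g) (gaU_is_additive g).

Lemma gacoefU c g1 g2 : gacoef g2 (gaU g1 c) = c *+ (g1 == g2).
Proof. exact: mcoeffU. Qed.

Lemma gacoefZ c f g : gacoef g (c *: f) = c * gacoef g f.
Proof. exact: mcoeffZ. Qed.

Lemma gacoef_neq0 g f : (gacoef g f != 0) = (g \in gasupp f).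
Proof. exact: mcoeff_neq0. Qed.

Lemma gacoef_notin f g : g \notin gasupp f -> gacoef g f = 0.
Proof. exact: mcoeff_outdom. Qed.

Lemma gaE f : f = \sum_(g <- gasupp f) gaU g (gacoef g f).
Proof. exact: monalgE. Qed.

Lemma gacoefM f1 f2 g :
  gacoef g (gamul f1 f2) =
  \sum_(g1 <- gasupp f1) gacoef g1 f1 * gacoef (g1^-1 * g)%g f2.
Proof.
rewrite /gamul raddf_sum; apply: eq_bigr => g1 _; rewrite raddf_sum /=.
rewrite [f2 in RHS]gaE raddf_sum mulr_sumr; apply: eq_bigr => g2 _.
rewrite /= !gacoefU mulrnAr; congr (_ *+ nat_of_bool _).
by apply/eqP/eqP => [<-|->]; rewrite (mulKg, mulVKg).
Qed.

Lemma gacoefMw (d : {fset G}) f1 f2 g : gasupp f1 `<=` d ->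
  gacoef g (gamul f1 f2) =
  \sum_(g1 <- d) gacoef g1 f1 * gacoef (g1^-1 * g)%g f2.
Proof.
move=> le_d; rewrite gacoefM; apply: big_fset_incl => // g1 _.
by move=> /gacoef_notin->; rewrite mul0r.
Qed.

Lemma gamulDl : left_distributive gamul +%R.
Proof.
move=> f1 f2 f3; apply/gaP => g; rewrite raddfD /=.
set d := gasupp f1 `|` gasupp f2.
rewrite !(@gacoefMw d) ?fsubsetUl ?fsubsetUr ?msuppD_le // -big_split /=.
by apply: eq_bigr => g1 _; rewrite raddfD mulrDl.
Qed.

Lemma gamulDr : right_distributive gamul +%R.
Proof.
move=> f1 f2 f3; apply/gaP => g; rewrite raddfD /= !gacoefM -big_split.
by apply: eq_bigr => g1 _; rewrite raddfD mulrDr.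
Qed.

Lemma gamulZl c f1 f2 : gamul (c *: f1) f2 = c *: gamul f1 f2.
Proof.
apply/gaP => g; rewrite gacoefZ (gacoefMw _ _ (msuppZ_le _ _)) gacoefM mulr_sumr.
by apply: eq_bigr => g1 _; rewrite gacoefZ mulrA.
Qed.

Lemma gacoefUM c g1 f g :
  gacoef g (gamul (gaU g1 c) f) = c * gacoef (g1^-1 * g)%g f.
Proof.
by rewrite (gacoefMw _ _ msuppU_le) big_seq_fset1 gacoefU eqxx.
Qed.

Lemma gamulUU g1 c1 g2 c2 :
  gamul (gaU g1 c1) (gaU g2 c2) = gaU (g1 * g2)%g (c1 * c2).
Proof.
apply/gaP => g; rewrite gacoefUM !gacoefU mulrnAr.
by congr (_ *+ nat_of_bool _); apply/eqP/eqP => [->|<-]; rewrite (mulKg, mulVKg).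
Qed.

Lemma gamul0f : left_zero 0 gamul.
Proof. by move=> f; rewrite /gamul /gasupp msupp0 big_seq_fset0. Qed.

Lemma gamulf0 : right_zero 0 gamul.
Proof. by move=> f; apply: (addrI (gamul f 0)); rewrite -gamulDr !addr0. Qed.

Lemma gamul_suml (r : seq G) (F : G -> A) f :
  gamul (\sum_(g <- r) F g) f = \sum_(g <- r) gamul (F g) f.
Proof. exact: (big_morph (gamul^~ f) (fun _ _ => gamulDl _ _ _) (gamul0f _)). Qed.

Lemma gamul_sumr (r : seq G) (F : G -> A) f :
  gamul f (\sum_(g <- r) F g) = \sum_(g <- r) gamul f (F g).
Proof. exact: (big_morph (gamul f) (fun _ _ => gamulDr _ _ _) (gamulf0 _)). Qed.

Lemma gamulA : associative gamul.
Proof.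
move=> f1 f2 f3; rewrite [f1]gaE (gamul_suml _ _ (gamul f2 f3)).
rewrite (gamul_suml _ _ f2) gamul_suml; apply: eq_bigr => g1 _.
rewrite [f2]gaE (gamul_suml _ _ f3) (gamul_sumr _ _ (gaU _ _)).
rewrite (gamul_sumr _ _ (gaU _ _)) gamul_suml; apply: eq_bigr => g2 _.
apply/gaP => g; rewrite gamulUU !gacoefUM mulrA; congr (_ * gacoef _ _).
by rewrite invgM mulgA.
Qed.

Lemma gamul1f : left_id (gaU 1%g 1) gamul.
Proof. by move=> f; apply/gaP => g; rewrite gacoefUM mul1r invg1 mul1g. Qed.

Lemma gamulf1 : right_id (gaU 1%g 1) gamul.
Proof.
move=> f; rewrite {1}[f]gaE gamul_suml [RHS]gaE; apply: eq_bigr => g _.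
by rewrite gamulUU mulg1 mulr1.
Qed.

Lemma gaU1_neq0 : gaU 1%g 1 != 0.
Proof.
apply/eqP => /(congr1 (gacoef 1%g)); rewrite gacoefU eqxx raddf0.
exact/eqP/oner_neq0.
Qed.

HB.instance Definition _ := GRing.Zmodule_isNzRing.Build A
  gamulA gamul1f gamulf1 gamulDl gamulDr gaU1_neq0.

Lemma gascaleAl c f1 f2 : c *: (f1 * f2) = (c *: f1) * f2.
Proof. by rewrite -[LHS]gamulZl. Qed.

HB.instance Definition _ := GRing.Lmodule_isLalgebra.Build K A gascaleAl.

Lemma gascaleAr c f1 f2 : c *: (f1 * f2) = f1 * (c *: f2).
Proof.
apply/gaP => g; rewrite gacoefZ [gacoef g _]gacoefM [RHS]gacoefM mulr_sumr.
by apply: eq_bigr => g1 _; rewrite gacoefZ mulrCA.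
Qed.

HB.instance Definition _ := GRing.Lalgebra_isAlgebra.Build K A gascaleAr.

End GroupAlgebra.

Local Open Scope classical_set_scope.

Section RightIdeals.
Variable R : nzRingType.

Definition right_ideal (I : set R) : Prop :=
  [/\ I 0, forall f g, I f -> I g -> I (f + g) & forall f g, I f -> I (f * g)].

Definition right_ideal_gen (X : set R) : set R := smallest right_ideal X.

End RightIdeals.

Section Exposure.
Variables (K : fieldType) (S : finType).
Local Notation F := (freegroup S).
Local Notation A := (grpalg K F).
Variable le : rel F.
Implicit Types (u v w : F) (T : set F) (f g : A) (I J : set A).

Definition supp f : set F := [set` gasupp f].

Definition supported T f : Prop := supp f `<=` T.

Definition Sp T : set A :=
  [set f | exists (r : seq F) (c : F -> K),
    (forall w, w \in r -> T w) /\ f = \sum_(w <- r) c w *: (gaU w 1 : A)].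

Lemma SpE T : Sp T = [set f | supported T f].
Proof.
apply/seteqP; split => f /=.
  move=> [r [c [rT ->]]] w; rewrite /supp /= -gacoef_neq0 => fw; apply: rT.
  apply: contraNT fw => wr; rewrite raddf_sum /=.
  rewrite big_seq big1 ?eqxx // => v vr; rewrite gacoefZ gacoefU.
  by case: eqP vr wr => [-> ->|]; rewrite ?mulr0.
move=> fT; exists (gasupp f), (fun w => gacoef w f); split => //.
rewrite {1}[f]gaE; apply: eq_bigr => w _; apply/gaP => v.
by rewrite gacoefZ !gacoefU mulrnAr mulr1.
Qed.

(* The relation le is the reflexive order "precedes or equals". A well_order   *)
(* of wochoice is in particular a total order.                                 *)
Definition exposure_order : Prop :=
  well_order le /\ forall u v, is_prefix u v -> le u v.

Definition prec u v : bool := (u != v) && le u v.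

Definition prec_min T1 T2 : Prop :=
  exists2 w, minimum_of le [in T1 `+` T2] w & T1 w.

Definition prec_max T1 T2 : Prop :=
  exists2 w, maximum_of le [in T1 `+` T2] w & T2 w.

(* head term and its coefficient; the values at f = 0 are irrelevant *)
Definition HT f : F := xget 1%g [set w | maximum_of le [in gasupp f] w].

Definition HC f : K := gacoef (HT f) f.

Definition is_monic f : Prop := f != 0 /\ HC f = 1.

Definition nonscalar f : Prop := ~ exists c : K, f = c%:A.

(* the last letter of a word, as an element of the group (1 for the empty word) *)
Definition last_letter w : F :=
  if rev (fgword w) is x :: _ then letter_elt x else 1%g.

Definition HTT f : F := last_letter (HT f).

Definition prefix_closed T : Prop :=
  forall u v, is_prefix u v -> T v -> T u.

Definition schreier_transversal I T : Prop :=
  [/\ prefix_closed T, Sp T `&` I = [set 0] &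
      forall f, exists2 g, Sp T g & I (g - f)].

Definition min_transversal I : set F :=
  xget set0 [set T | schreier_transversal I T /\
    forall T', schreier_transversal I T' -> T' <> T -> prec_min T T'].

Definition normal_form I f : A :=
  xget 0 [set g | supported (min_transversal I) g /\ I (g - f)].

Definition monic_multiple f : A := (HC f)^-1 *: f.

Definition second I f : A :=
  monic_multiple (normal_form I (f * gaU (HTT f)^-1%g 1)).

(* g is the element of I exposed after those that generate J *)
Definition exposed_next I J g : Prop :=
  let candidate h :=
    [/\ I h, is_monic h & supported (min_transversal J) h] in
  candidate g /\ forall h, candidate h -> supp h <> supp g -> prec_max (supp g) (supp h).

(* The exposure process of I is a family indexed by the ordinals below omega_I, *)
(* that is, by a well-ordered type (W, leW).                                    *)
Definition exposed_before (W : Type) (leW : rel W) (fam : W -> A) (a : W) : set A :=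
  right_ideal_gen [set fam b | b in [set b | leW b a /\ b <> a]].

Definition exposure_process I (W : Type) (leW : rel W) (fam : W -> A) : Prop :=
  [/\ well_order leW,
      forall a, exposed_before leW fam a <> I,
      forall a, exposed_next I (exposed_before leW fam a) (fam a) &
      right_ideal_gen (range fam) = I].

Definition exposure_basis I : set A :=
  [set g | exists (W : Type) (leW : rel W) (fam : W -> A),
     exposure_process I leW fam /\ range fam g].

Definition exposure_seconds I : set A :=
  [set g | exists (W : Type) (leW : rel W) (fam : W -> A),
     exposure_process I leW fam /\
     exists a, g = second (exposed_before leW fam a) (fam a)].

Definition groebner_basis I : set A :=
  [set g | (I = setT /\ g = 1) \/
           (I <> setT /\ (exposure_basis I `|` exposure_seconds I) g)].

Definition exposure_extending I f : Prop :=
  [/\ nonscalar f, is_monic f, supported (min_transversal I) f,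
      forall f', exposure_basis I f' -> prec (HT f') (HT f) &
      prec (HT f) (HT (second I f))].

End Exposure.

(* Main.v *)
Require Import Defs.
From HB Require Import structures.
From mathcomp Require Import all_boot all_order all_algebra.
From mathcomp Require Import finmap.
From mathcomp.multinomials Require Import monalg.
From mathcomp Require Import boolp classical_sets functions wochoice.

(* Write T for T_I, h for HT(f) and V for the span of the words of T below h. The
   crux is that V meets I' = I + f A trivially. Right multiplication by a letter,
   taken modulo I, is a partial injective linear map of V; the relation f extends
   the map of the last letter b of h = p b by p b = h - f, and this stays injective
   because the second of f lies above h. Partial injective linear maps extend to
   automorphisms of a larger space, which becomes a K[F]-module. Following words
   of T from the vector 1 shows that the exposure basis of I, whose heads are below
   h, and f annihilate 1, whereas V is embedded; hence V and I' intersect in 0.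

   For every right ideal I the elements w - phi_I(w), with w a minimal word outside
   T_I, generate I, and discarding those that follow from smaller ones gives the
   exposure process explicitly, without transfinite recursion. By the crux each
   of its steps for I remains a step for I', and f is exposed right after them. *)

Set Implicit Arguments.
Unset Strict Implicit.
Unset Printing Implicit Defensive.

Import GRing.Theory.

Local Open Scope ring_scope.
Local Open Scope classical_set_scope.

(** * Well-orders and reduced words *)

Section WellOrders.
Variables (T : Type) (R : rel T).
Hypothesis Rwo : well_order R.

(** [well_order] quantifies over boolean predicates; [asbool] makes it apply to arbitrary
    properties. *)
Lemma wo_min (P : T -> Prop) :
  (exists x, P x) -> exists2 x, P x & forall y, P y -> R x y.
Proof.
move=> [x Px]; have [|z [[/asboolP Pz zmin] _]] := Rwo (A := fun x => `[< P x >]).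
  by exists x; apply/asboolP.
by exists z => // y Py; apply: zmin; apply/asboolP.
Qed.

Lemma wo_refl x : R x x.
Proof. by have [|y -> ->] := @wo_min (eq^~ x); first by exists x. Qed.

Lemma wo_total x y : R x y \/ R y x.
Proof.
have [|z zxy zmin] := @wo_min (fun z => z = x \/ z = y); first by exists x; left.
by case: zxy zmin => -> zmin; [left|right]; apply: zmin; [right|left].
Qed.

(** Both elements are least in the pair they form, and a well-order has only one least element
    there. *)
Lemma wo_anti x y : R x y -> R y x -> x = y.
Proof.
move=> Rxy Ryx; have [|z [_ zuniq]] := Rwo (A := fun z => `[< z = x \/ z = y >]).
  by exists x; apply/asboolP; left.
rewrite -[LHS]zuniq -?[RHS]zuniq //; split=> [|t /asboolP[]->]; rewrite ?wo_refl //.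
  by apply/asboolP; right.
by apply/asboolP; left.
Qed.

Lemma wo_trans x y z : R x y -> R y z -> R x z.
Proof.
move=> Rxy Ryz.
have [|t txyz tmin] := @wo_min (fun t => [\/ t = x, t = y | t = z]).
  by exists x; apply: Or31.
have [Rtx Rty Rtz] : [/\ R t x, R t y & R t z].
  by split; apply: tmin; [apply: Or31|apply: Or32|apply: Or33].
case: txyz Rtx Rty Rtz => -> // Rtx Rty _; first by rewrite (wo_anti Rxy Rtx).
by rewrite -(wo_anti Ryz Rty).
Qed.

Lemma wo_ind (P : T -> Prop) :
  (forall x, (forall y, R y x -> y <> x -> P y) -> P x) -> forall x, P x.
Proof.
move=> IH x; apply: contrapT => nPx.
have [|z nPz zmin] := @wo_min (fun z => ~ P z); first by exists x.
apply: nPz; apply: IH => y Ryz yz; apply: contrapT => /zmin Rzy.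
exact/yz/wo_anti.
Qed.

End WellOrders.

Lemma wo_max (T : eqType) (R : rel T) (s : seq T) :
  well_order R -> s != [::] -> exists2 x, x \in s & {in s, forall y, R y x}.
Proof.
move=> Rwo; elim: s => // x s IHs _.
have [->|/IHs[z zs zmax]] := eqVneq s [::].
  by exists x; rewrite ?inE // => y; rewrite inE => /eqP->; apply: wo_refl.
have [Rxz|Rzx] := wo_total Rwo x z.
  by exists z => [|t]; rewrite inE ?zs ?orbT // => /predU1P[->//|/zmax].
exists x => [|t]; rewrite inE ?eqxx // => /predU1P[->|/zmax Rtz].
  exact: wo_refl.
exact: wo_trans Rzx.
Qed.

Section Words.
Variable S : finType.
Implicit Types (c : letter S) (u v w p : freegroup S).

Lemma wmul_cat (s t : seq (letter S)) : reduced (s ++ t) -> wmul s t = s ++ t.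
Proof.
elim: s => //= c s IHs rst.
by rewrite /wmul /= -/(wmul _ _) IHs ?push_reduced //; apply: path_sorted rst.
Qed.

Lemma fg_rcons w (s : seq (letter S)) c : fgword w = rcons s c ->
  exists p, [/\ fgword p = s, w = (p * letter_elt c)%g, is_prefix p w & p != w].
Proof.
move=> wE; have rs : reduced s.
  by have := valP w; rewrite /= wE -cats1 /reduced => /cat_sorted2[].
exists (FreeGroup rs); split=> //.
- by apply: val_inj; rewrite /= wmul_cat cats1 -wE //; apply: valP.
- by rewrite /is_prefix /= wE -cats1 prefix_prefix.
apply/eqP => /(congr1 (size \o @fgword S)) /=.
by rewrite wE size_rcons => /n_Sn.
Qed.

Lemma letter_eltV c : (letter_elt c)^-1%g = letter_elt (linv c).
Proof. exact: val_inj. Qed.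

(** If the letter does not extend the reduced word, it cancels the last letter of [u], and the
    product is [u] without it. *)
Lemma fg_mul_letter u c :
  is_prefix (u * letter_elt c)%g u \/
  fgword (u * letter_elt c)%g = rcons (fgword u) c.
Proof.
have [ruc|] := boolP (reduced (rcons (fgword u) c)).
  by right; rewrite /= wmul_cat cats1.
move E: (fgword u) => t; case/lastP: t E => // t d uE nr; left.
have [p [_ upd pu _]] := fg_rcons uE.
suff dE : d = linv c.
  by rewrite [X in is_prefix (X * _)%g]upd -mulgA dE -letter_eltV mulVg mulg1.
have : reduced (rcons t d) by rewrite -uE; apply: valP.
move: nr; rewrite /reduced; case: t {uE} => [|x t] /=.
  by rewrite andbT negbK => /eqP->; rewrite linvK.
rewrite rcons_path last_rcons negb_and => /orP[/negbTE->//|].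
by rewrite negbK => /eqP->; rewrite linvK.
Qed.

Section Action.
Variables (X : Type) (rho : letter S -> X -> X).
Hypothesis rhoK : forall c, cancel (rho (linv c)) (rho c).

Definition act (s : seq (letter S)) x := foldl (fun x c => rho c x) x s.

(** The one case to check is a cancellation in [push], where [rhoK] makes the two maps cancel as
    well. *)
Lemma act_push c s x : act (push c s) x = act s (rho c x).
Proof.
case: s => //= d s; case: eqP => //= ->; congr (act s _).
by have := rhoK (linv c) x; rewrite linvK => ->.
Qed.

Lemma act_mul u v x : act (u * v)%g x = act v (act u x).
Proof.
rewrite [fgword _]/=; elim: (fgword u) x => //= c s IHs x.
by rewrite act_push IHs.
Qed.

End Action.
End Words.

(** * Subspaces, supports and head terms *)

Section Subspaces.
Variables (K : fieldType) (V : lmodType K).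
Implicit Types (D : set V) (x y : V).

Definition subspace D : Prop :=
  [/\ D 0, forall x y, D x -> D y -> D (x + y) & forall a x, D x -> D (a *: x)].

Lemma subspace0 D : subspace D -> D 0.
Proof. by case. Qed.

Lemma subspaceD D x y : subspace D -> D x -> D y -> D (x + y).
Proof. by case=> _ DD _; apply: DD. Qed.

Lemma subspaceZ D a x : subspace D -> D x -> D (a *: x).
Proof. by case=> _ _; apply. Qed.

Lemma subspaceN D x : subspace D -> D x -> D (- x).
Proof. by move=> sD Dx; rewrite -scaleN1r; apply: subspaceZ. Qed.

Lemma subspaceB D x y : subspace D -> D x -> D y -> D (x - y).
Proof. by move=> sD Dx Dy; apply: subspaceD => //; apply: subspaceN. Qed.

Lemma subspace_sum D (J : eqType) (r : seq J) (G : J -> V) :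
  subspace D -> {in r, forall i, D (G i)} -> D (\sum_(i <- r) G i).
Proof.
move=> sD DG; rewrite big_seq; apply: big_ind => //; first exact: subspace0.
by move=> x y; apply: subspaceD.
Qed.

End Subspaces.

Section RightIdealGen.
Variable R : nzRingType.
Implicit Types (J X Y : set R).

Lemma right_ideal_gen_ideal X : right_ideal (right_ideal_gen X).
Proof.
split=> [|f g Xf Xg|f g Xf] J [Jid XJ]; have [J0 JD JM] := Jid => //.
  by apply: JD; [apply: Xf|apply: Xg].
by apply: JM; apply: Xf.
Qed.

Lemma right_ideal_gen_sub X J :
  right_ideal J -> X `<=` J -> right_ideal_gen X `<=` J.
Proof. exact: smallest_sub. Qed.

Lemma right_ideal_gen_in X : X `<=` right_ideal_gen X.
Proof. exact: sub_gen_smallest. Qed.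

Lemma right_ideal_genS X Y :
  X `<=` Y -> right_ideal_gen X `<=` right_ideal_gen Y.
Proof.
move=> XY; apply: right_ideal_gen_sub; first exact: right_ideal_gen_ideal.
exact: subset_trans XY (@right_ideal_gen_in _).
Qed.

End RightIdealGen.

Section GroupAlgebraFacts.
Variables (K : fieldType) (G : groupType).
Local Notation A := (grpalg K G).
Implicit Types (f g : A) (u v w : G) (T : set G) (D I : set A).

Definition mon w : A := gaU w 1.

Lemma gaU_mon w (c : K) : gaU w c = c *: mon w.
Proof. by apply/gaP => v; rewrite gacoefZ !gacoefU mulrnAr mulr1. Qed.

Lemma gacoef_mon u v : gacoef v (mon u) = (u == v)%:R :> K.
Proof. exact: gacoefU. Qed.

Lemma mon1 : mon 1%g = 1.
Proof. by []. Qed.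

Lemma monM u v : mon u * mon v = mon (u * v)%g.
Proof. by rewrite [LHS]gamulUU mulr1. Qed.

Lemma monMK f u : f * mon u * mon u^-1%g = f.
Proof. by rewrite -mulrA monM mulgV mon1 mulr1. Qed.

Lemma gaE_mon f : f = \sum_(w <- gasupp f) gacoef w f *: mon w.
Proof. by rewrite {1}[f]gaE; apply: eq_bigr => w _; rewrite gaU_mon. Qed.

Lemma subspace_supp D f :
  subspace D -> (forall w, gacoef w f != 0 -> D (mon w)) -> D f.
Proof.
move=> sD Df; rewrite [f]gaE_mon; apply: subspace_sum => // w.
by rewrite -gacoef_neq0 => /Df; apply: subspaceZ.
Qed.

Lemma right_ideal_subspace I : right_ideal I -> subspace I.
Proof.
case=> I0 ID IM; split=> // a f If.
by rewrite -[f]mulr1 scalerAr; apply: IM.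
Qed.

Lemma right_ideal_1 I : right_ideal I -> I 1 -> I = setT.
Proof.
by case=> _ _ IM I1; apply/seteqP; split=> // f _; rewrite -[f]mul1r; apply: IM.
Qed.

End GroupAlgebraFacts.

Section Supports.
Variables (K : fieldType) (S : finType).
Local Notation F := (freegroup S).
Local Notation A := (grpalg K F).
Implicit Types (f g : A) (u v w : F) (T : set F).

Lemma supportedP T f : supported T f <-> forall w, gacoef w f != 0 -> T w.
Proof.
split=> fT w; first by rewrite gacoef_neq0; apply: fT.
by rewrite /supp /= -gacoef_neq0; apply: fT.
Qed.

Lemma supported_in T f w : supported T f -> gacoef w f != 0 -> T w.
Proof. by move=> /supportedP; apply. Qed.

Lemma supported_subspace T : subspace (supported (K := K) T).
Proof.
split=> [|f g /supportedP fT /supportedP gT|a f /supportedP fT]; apply/supportedP => w.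
- by rewrite raddf0 eqxx.
- have [f0|/fT//] := eqVneq (gacoef w f) 0.
  by rewrite raddfD /= f0 add0r => /gT.
- by rewrite gacoefZ mulf_eq0 negb_or => /andP[_ /fT].
Qed.

Lemma supported_mon T w : T w -> supported T (mon K w).
Proof.
move=> Tw; apply/supportedP => v; rewrite gacoef_mon.
by case: (eqVneq w v) => [<-|]; rewrite ?eqxx.
Qed.

Lemma supportedS T T' f : T `<=` T' -> supported T f -> supported T' f.
Proof. by move=> TT' fT; apply: subset_trans TT'. Qed.

Lemma supported0 T f : T `<=` set0 -> supported T f -> f = 0.
Proof.
move=> T0 /supportedP fT; apply/gaP => w; rewrite raddf0.
by apply/eqP/negPn/negP => /fT/T0.
Qed.

Variable le : rel F.
Hypothesis le_wo : well_order le.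

Lemma prec_irr w : prec le w w = false.
Proof. by rewrite /prec eqxx. Qed.

Lemma prec_le u v : prec le u v -> le u v.
Proof. by case/andP. Qed.

Lemma le_prec_trans v u w : le u v -> prec le v w -> prec le u w.
Proof.
move=> luv /andP[vw lvw]; rewrite /prec (wo_trans le_wo luv lvw) andbT.
by apply: contraNneq vw => uw; rewrite (wo_anti le_wo lvw) // -uw.
Qed.

Lemma prec_trans v u w : prec le u v -> prec le v w -> prec le u w.
Proof. by move=> /prec_le; apply: le_prec_trans. Qed.

Lemma precNle u v : prec le u v -> ~~ le v u.
Proof.
by case/andP=> uv luv; apply: contraNN uv => lvu; rewrite (wo_anti le_wo luv lvu).
Qed.

Lemma leP_prec u v : le u v \/ prec le v u.
Proof.
have [|luv] := wo_total le_wo u v; first by left.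
by rewrite /prec luv andbT; case: (eqVneq v u) luv => [->|_]; [left|right].
Qed.

Lemma le_eqVprec u v : le u v -> u = v \/ prec le u v.
Proof.
by move=> luv; rewrite /prec luv andbT; case: (eqVneq u v); [left|right].
Qed.

Lemma prec_ind (P : F -> Prop) :
  (forall w, (forall u, prec le u w -> P u) -> P w) -> forall w, P w.
Proof.
move=> IH; apply: (wo_ind le_wo) => w IHw; apply: IH => u /andP[/eqP uw luw].
exact: IHw.
Qed.

Definition below T w : set F := T `&` [set u | prec le u w].

Lemma HTP f : f != 0 ->
  gacoef (HT le f) f != 0 /\ forall w, gacoef w f != 0 -> le w (HT le f).
Proof.
move=> f0; suff /xgetPex : exists w, maximum_of le [in gasupp f] w.
  by move=> /(_ 1%g) [/= hf hmax]; split=> [|w]; rewrite gacoef_neq0 // => /hmax.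
have [|w wf wmax] := @wo_max _ le (gasupp f) le_wo; last by exists w.
apply: contra_neq f0 => f0; apply/gaP => w; rewrite raddf0.
by apply: gacoef_notin; rewrite -[_ \in _]/(w \in (gasupp f : seq F)) f0.
Qed.

Lemma HT_eq f w : gacoef w f != 0 ->
  (forall v, gacoef v f != 0 -> le v w) -> HT le f = w.
Proof.
move=> fw wmax; have /HTP[hf hmax] : f != 0.
  by apply: contraNneq fw => ->; rewrite raddf0.
by apply: (wo_anti le_wo); [apply: wmax|apply: hmax].
Qed.

Lemma HT0 : HT le (0 : A) = 1%g.
Proof.
rewrite /HT xgetPN // => w [/=].
by rewrite -gacoef_neq0 raddf0 eqxx.
Qed.

Lemma HTZ a f : a != 0 -> HT le (a *: f) = HT le f.
Proof.
move=> a0; have [->|/HTP[hf hmax]] := eqVneq f 0; first by rewrite scaler0.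
apply: HT_eq => [|v]; rewrite gacoefZ mulf_eq0 negb_or ?a0 ?hf //=.
exact: hmax.
Qed.

(** A relation is solved for its head term: after division by the head coefficient, all other words
    are smaller. *)
Lemma head_reduces (D : set A) T f : subspace D -> supported T f -> D f -> f != 0 ->
  exists2 g, supported (below T (HT le f)) g & D (mon K (HT le f) - g).
Proof.
move=> sD fT Df f0; have [hf hmax] := HTP f0; set h := HT le f in hf hmax *.
exists (mon K h - (gacoef h f)^-1 *: f); last by rewrite subKr; apply: subspaceZ.
apply/supportedP => w; rewrite raddfB /= gacoefZ gacoef_mon.
have [<-|nhw] := eqVneq h w; first by rewrite mulVf // subrr eqxx.
rewrite sub0r oppr_eq0 mulf_eq0 negb_or => /andP[_ fw]; split.
  exact: supported_in fT fw.
by rewrite /= /prec eq_sym nhw hmax.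
Qed.

End Supports.

(** * Schreier transversals *)

Lemma symdiffP (T : Type) (X Y : set T) x :
  (x \in X `+` Y) <-> (X x /\ ~ Y x) \/ (Y x /\ ~ X x).
Proof. by rewrite in_setE. Qed.

Section Prefixes.
Variable S : finType.
Implicit Types u v w t : freegroup S.

Lemma is_prefix_rcons u w t c : fgword w = rcons (fgword t) c ->
  is_prefix u w -> u != w -> is_prefix u t.
Proof.
rewrite /is_prefix => wE; rewrite wE; case/prefixP => s sE uw.
case/lastP: s sE => [|s d].
  by rewrite cats0 -wE => /val_inj wu; rewrite wu eqxx in uw.
by rewrite -rcons_cat => /rcons_inj[-> _]; apply: prefix_prefix.
Qed.

Lemma is_prefix_refl u : is_prefix u u.
Proof. exact: prefix_refl. Qed.

Lemma is_prefix1 u : is_prefix 1%g u.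
Proof. exact: prefix0s. Qed.

End Prefixes.

Section Transversals.
Variables (K : fieldType) (S : finType).
Local Notation F := (freegroup S).
Local Notation A := (grpalg K F).
Local Notation mon := (mon K).
Variable le : rel F.
Hypothesis le_exp : exposure_order le.
Implicit Types (f g : A) (u v w t p : F) (T : set F) (I J : set A).

Let le_wo : well_order le := le_exp.1.

Lemma prefix_le u v : is_prefix u v -> le u v.
Proof. exact: le_exp.2. Qed.

Lemma prefix_prec u v : is_prefix u v -> u != v -> prec le u v.
Proof. by move=> uv nuv; rewrite /prec nuv prefix_le. Qed.

(** Minimality outside [T] is meant for the prefix order, not for [le]. *)
Definition boundary T w : Prop :=
  (forall u, is_prefix u w -> u != w -> T u) /\ ~ T w.

(** A word of [T] times a letter is in [T] or on the boundary, as a cancellation only leads to a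
    prefix. Reducing after each letter therefore needs no relations but those at boundary words. *)
Lemma boundary_reduces_span T J : prefix_closed T -> right_ideal J ->
    (forall w, boundary T w -> exists2 g, supported T g & J (mon w - g)) ->
  forall f, exists2 g, supported T g & J (f - g).
Proof.
move=> Tcl Jid Jbd; have Jsub := right_ideal_subspace Jid.
pose D : set A := [set f | exists2 g, supported T g & J (f - g)].
have sD : subspace D.
  have sT := supported_subspace K T; split=> [|f1 f2|a f].
  - by exists 0; [exact: subspace0 sT|rewrite subr0; exact: subspace0 Jsub].
  - move=> [g1 g1T J1] [g2 g2T J2]; exists (g1 + g2); first exact: (subspaceD sT).
    by rewrite opprD addrACA; apply: (subspaceD Jsub J1 J2).
  - move=> [g gT Jg]; exists (a *: g); first exact: (subspaceZ a sT).
    by rewrite -scalerBr; apply: (subspaceZ a Jsub Jg).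
have DJ f g : D g -> J (f - g) -> D f.
  move=> [k kT Jk] Jfg; exists k => //.
  by rewrite -(subrK g f) -addrA; apply: subspaceD.
have Dw w : (forall u, is_prefix u w -> u != w -> T u) -> D (mon w).
  move=> Tw; have [wT|nTw] := pselect (T w); last exact: Jbd.
  by exists (mon w); [apply: supported_mon|rewrite subrr; exact: subspace0 Jsub].
have DM f c : D f -> D (f * mon (letter_elt c)).
  move=> [g gT Jfg]; apply: (DJ _ (g * mon (letter_elt c))); last first.
    by rewrite -mulrBl; case: Jid => _ _; apply.
  pose D' : set A := [set g | D (g * mon (letter_elt c))].
  suff : D' g by [].
  apply: subspace_supp => [|t /(supported_in gT)Tt].
    split=> [|g1 g2 D1 D2|a g1 D1].
    + by rewrite /D' /= mul0r; exact: subspace0 sD.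
    + by rewrite /D' /= mulrDl; exact: (subspaceD sD D1 D2).
    + by rewrite /D' /= -scalerAl; exact: (subspaceZ a sD D1).
  rewrite /D' /= monM; apply: Dw => u utc uN.
  have [tct|tcE] := fg_mul_letter t c.
    apply: Tcl Tt; exact: prefix_trans utc tct.
  by apply: Tcl Tt; exact: is_prefix_rcons tcE utc uN.
move=> f; apply: (@subspace_supp _ _ D) => // w _.
elim: {w}(size (fgword w)) {-2}w (erefl (size (fgword w))) => [|n IHn] w.
  move=> /size0nil w0; apply: Dw => u; rewrite /is_prefix w0 prefixs0.
  by move=> /eqP u0 /negP[]; apply/eqP/val_inj; rewrite /= u0 w0.
case E : _ / (lastP (fgword w)) => [|s c] //.
have [p [pE wpc _ _]] := fg_rcons E.
rewrite size_rcons -pE => -[pn].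
by rewrite wpc -monM; apply/DM/IHn.
Qed.

(* Characterizes the least Schreier transversal without mentioning the others. *)
Definition greedy I T : Prop := forall w, T w <->
  (forall u, is_prefix u w -> u != w -> T u) /\
  ~ exists2 g, supported (below le T w) g & I (mon w - g).

(** Membership of [w] depends only on words before [w], since proper prefixes come earlier;
    well-founded recursion therefore defines the set. *)
Lemma greedy_exists I : exists T, greedy I T.
Proof.
pose body w (rec : forall u, prec le u w -> Prop) : Prop :=
  (forall u (uw : prec le u w), is_prefix u w -> rec u uw) /\
  ~ exists2 g, supported [set u | exists uw : prec le u w, rec u uw] g
             & I (mon w - g).
have wf : well_founded (fun u w => prec le u w).
  by apply: (prec_ind le_wo) => w IH; constructor.
pose T : set F := Fix wf (fun=> Prop) body; exists T => w.
have -> : T w = body w (fun u _ => T u).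
  apply: Fix_eq => v r1 r2 r12; congr (body v _).
  by apply: functional_extensionality_dep => u;
    apply: functional_extensionality_dep => p; apply: r12.
have belowE : [set u | exists _ : prec le u w, T u] = below le T w.
  by apply/seteqP; split => u [].
rewrite /body belowE; split=> -[T1 T2]; split=> // u.
  by move=> uw nuw; apply: T1 => //; apply: prefix_prec.
by move=> /andP[nuw _] uw; apply: T1.
Qed.

Section Greedy.
Variables (I : set A) (T : set F).
Hypotheses (I_id : right_ideal I) (T_greedy : greedy I T).

Lemma greedy_closed : prefix_closed T.
Proof.
move=> u v uv Tv; have [->//|nuv] := eqVneq u v.
by have [/(_ u uv nuv)] := (T_greedy v).1 Tv.
Qed.

(** The head term of a nonzero relation would reduce to smaller words of [T], and [T] contains no
    such word. *)
Lemma greedy_free f : supported T f -> I f -> f = 0.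
Proof.
move=> fT If; apply/eqP/negPn/negP => f0.
have [hf _] := HTP le_wo f0.
have [_ []] := (T_greedy (HT le f)).1 (supported_in fT hf).
exact: head_reduces (right_ideal_subspace I_id) fT If f0.
Qed.

Lemma greedy_boundary w : boundary T w ->
  exists2 g, supported (below le T w) g & I (mon w - g).
Proof.
by move=> [Tw nTw]; apply: contrapT => nex; apply/nTw/T_greedy.
Qed.

Lemma greedy_span f : exists2 g, supported T g & I (f - g).
Proof.
apply: boundary_reduces_span => //; first exact: greedy_closed.
move=> w /greedy_boundary[g gT Ig]; exists g => //.
by apply: supportedS gT => u [].
Qed.

Lemma greedy_schreier : schreier_transversal I T.
Proof.
split; first exact: greedy_closed.
  rewrite SpE; apply/seteqP; split=> f /= => [[]|->]; first exact: greedy_free.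
  by split; [exact: subspace0 (supported_subspace K T)|case: I_id].
move=> f; have [g gT Ig] := greedy_span f; exists g; first by rewrite SpE.
by rewrite -opprB; apply: (subspaceN (right_ideal_subspace I_id)).
Qed.

(** Suppose that the first difference [w] is in [T'] only. Then [w] is a boundary word of [T] and
    reduces to smaller words, which [T] and [T'] share; this is a nontrivial relation on [T']. *)
Lemma greedy_min T' : schreier_transversal I T' -> T' <> T -> prec_min le T T'.
Proof.
move=> [T'cl /seteqP[T'free _] T'span] T'T.
have [|w wTT' wmin] := wo_min le_wo (P := fun w => w \in T `+` T').
  apply: contrapT => nex; apply: T'T; apply/seteqP.
  by split=> w Tw; apply: contrapT => nTw; apply: nex; exists w; apply/symdiffP;
    [right|left].
exists w => //; case/symdiffP: (wTT') => [[//]|[T'w nTw]].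
have TT' u : prec le u w -> (T u <-> T' u).
  move=> /(precNle le_wo) nwu.
  by split=> Tu; apply: contrapT => nTu; case/negP: nwu; apply: wmin; apply/symdiffP;
    [left|right].
have [|g gT Ig] := @greedy_boundary w.
  split=> // u uw nuw; apply/TT'; first exact: prefix_prec.
  exact: T'cl T'w.
have : mon w - g = 0.
  apply: T'free; split=> //; rewrite SpE; apply: (subspaceB (supported_subspace K T')).
  - exact: supported_mon.
  - by apply: supportedS gT => u [Tu uw]; apply/TT'.
move=> /(congr1 (gacoef w)); rewrite raddfB /= gacoef_mon eqxx raddf0.
have [->|/(supported_in gT)[_]] := eqVneq (gacoef w g) 0.
  by rewrite subr0 => /eqP; rewrite oner_eq0.
by rewrite /= prec_irr.
Qed.

End Greedy.

(** Another minimum and the greedy set would precede each other, so their first difference would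
    belong to both. *)
Lemma min_transversal_greedy I : right_ideal I -> greedy I (min_transversal le I).
Proof.
move=> I_id; have [T Tg] := greedy_exists I.
suff -> : min_transversal le I = T by [].
apply: xget_unique => [|T' [T's T'min]].
  split=> [|T' sT' TT']; first exact: greedy_schreier.
  exact: greedy_min.
apply: contrapT => T'T.
have [w [wTT' wmin] Tw] := greedy_min Tg T's T'T.
have [|v [vTT' vmin] T'v] := T'min _ (greedy_schreier I_id Tg); first by move=> /esym.
have vw : v = w.
  apply: (wo_anti le_wo); [apply: vmin|apply: wmin].
    by apply/symdiffP; case/symdiffP: wTT'; [right|left].
  by apply/symdiffP; case/symdiffP: vTT'; [right|left].
by rewrite vw in T'v; case/symdiffP: wTT' => -[].
Qed.

End Transversals.

(** * Extending partial linear bijections *)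

Lemma linear_bundle (K : fieldType) (U V : lmodType K) (h : U -> V) :
  linear h -> exists g : {linear U -> V}, g =1 h.
Proof.
move=> hlin; pose hL := GRing.isLinear.Build K U V _ h hlin.
by exists (HB.pack_for {linear U -> V} h hL).
Qed.

Lemma linear_facts (K : fieldType) (U V : lmodType K) (h : U -> V) : linear h ->
  [/\ h 0 = 0, forall x y, h (x + y) = h x + h y & forall a x, h (a *: x) = a *: h x].
Proof.
move=> /linear_bundle[g gE]; split=> [|x y|a x]; rewrite -!gE;
  by [apply: linear0|apply: linearD|apply: linearZ].
Qed.

Section Dilation.
Variables (K : fieldType) (S : finType) (V : lmodType K).
Variables (pi tau : letter S -> {linear V -> V}).
Hypothesis piK : forall c x, pi c (pi c x) = pi c x.
Hypothesis tau_pi : forall c x, tau c (pi c x) = tau c x.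
Hypothesis pi_tau : forall c x, pi (linv c) (tau c x) = tau c x.
Hypothesis tauK : forall c x, tau (linv c) (tau c x) = pi c x.
Implicit Types (c : letter S) (x : V).

(* [tau c] is a linear bijection from the image of the projection [pi c] to that
   of [pi (linv c)]. It becomes invertible on the functions from the sites of a
   two-sided infinite line, with [V] at the origin [None]: the complement of
   the domain is shifted outwards along one ray and the complement of the range
   inwards along the other. *)
Definition site : Type := option (bool * nat).
Definition hotel : Type := site -> V.
Implicit Types v : hotel.

(** One step towards the origin; [(b, 0)] is a neighbour of [None]. *)
Definition inward (i : bool * nat) : site :=
  if i.2 is n.+1 then Some (i.1, n) else None.

Lemma pi_tauV c x : pi c (tau (linv c) x) = tau (linv c) x.
Proof. by have := pi_tau (linv c) x; rewrite linvK. Qed.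

Lemma tauVK c x : tau c (tau (linv c) x) = pi (linv c) x.
Proof. by have := tauK (linv c) x; rewrite linvK. Qed.

Definition away c x : V := x - pi c x.

Lemma away_linear c : linear (away c).
Proof. by move=> a x y; rewrite /away linearP scalerBr opprD addrACA. Qed.

HB.instance Definition _ c :=
  GRing.isLinear.Build K V V _ (away c) (away_linear c).

Lemma pi_away c x : pi c (away c x) = 0.
Proof. by rewrite linearB /= piK subrr. Qed.

Lemma away_pi c x : away c (pi c x) = 0.
Proof. by rewrite /away piK subrr. Qed.

Lemma away_away c x : away c (away c x) = away c x.
Proof. by rewrite {1}/away pi_away subr0. Qed.

Lemma tau_away c x : tau c (away c x) = 0.
Proof. by rewrite linearB /= tau_pi subrr. Qed.

Lemma away_tau c x : away c (tau (linv c) x) = 0.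
Proof. by rewrite /away pi_tauV subrr. Qed.

(** On both rays the components in the images of the projections stay in place. The [away]
    components leave the origin along the ray labelled [c.2] and enter it along the other. *)
Definition dilate c v (i : site) : V :=
  match i with
  | None => tau c (v None) + away (linv c) (v (Some (~~ c.2, 0%N)))
  | Some j =>
      if j.1 == c.2 then pi c (v i) + away c (v (inward j))
      else pi (linv c) (v i) + away (linv c) (v (Some (j.1, j.2.+1)))
  end.

(** The letter [linv c] exchanges the two rays and so reverses the shifts; at the origin, the maps
    [tau] at the two letters invert each other between the images of the projections. *)
Lemma dilateK c : cancel (dilate (linv c)) (dilate c).
Proof.
have piD d x : pi d x + away d x = x by rewrite addrC subrK.
have tauD d x y : tau d (x + y) = tau d x + tau d y by exact: linearD.
have piA d x y : pi d (x + y) = pi d x + pi d y by exact: linearD.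
have awayD d x y : away d (x + y) = away d x + away d y by exact: linearD.
pose E := (tauD, piA, awayD, tauVK, pi_tauV, tau_away, away_tau, pi_away, away_pi,
  piK, away_away, addr0, add0r, piD).
move=> v; apply: funext => -[[b n]|]; rewrite /dilate linvK; last first.
  by rewrite /inward /= eqxx !E.
have [->|nb] := eqVneq b c.2; last first.
  have -> : b = ~~ c.2 by case: b c.2 nb => -[].
  by rewrite /inward /= eqxx !E.
by case: n => [|n]; rewrite /inward /= (_ : (c.2 == ~~ c.2) = false) ?E //; case: c.2.
Qed.

Lemma dilate_linear c : linear (dilate c).
Proof.
move=> a v w; apply: funext => i.
rewrite -[RHS]/(a *: dilate c v i + dilate c w i) /dilate.
have E j : (a *: v + w) j = a *: v j + w j by [].
have EP (h : {linear V -> V}) x y : h (a *: x + y) = a *: h x + h y by exact: linearP.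
by case: i => [j|]; [case: ifP => _|]; rewrite !E away_linear EP addrACA -scalerDr.
Qed.

Definition at_origin x : hotel := fun i => if i is Some _ then 0 else x.

Lemma at_origin_linear : linear at_origin.
Proof.
move=> a x y; apply: funext => -[j|//].
by rewrite -[RHS]/(a *: 0 + 0 : V) scaler0 addr0.
Qed.

(** A vector in the image of [pi c] has no [away] component, so nothing leaves the origin. *)
Lemma dilate_origin c x : pi c x = x -> dilate c (at_origin x) = at_origin (tau c x).
Proof.
have pi0 d : pi d 0 = 0 by exact: linear0.
have away0 d : away d 0 = 0 by exact: linear0.
move=> pix; apply: funext => -[[b n]|]; rewrite /dilate /=; last by rewrite away0 addr0.
case: ifP => _; rewrite pi0 ?away0 add0r //.
by case: n => [|n]; rewrite /inward /= ?away0 // /away pix subrr.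
Qed.

End Dilation.

(** * Evaluation of the group algebra at a vector *)

Section Evaluation.
Variables (K : fieldType) (S : finType) (X : lmodType K).
Local Notation A := (grpalg K (freegroup S)).
Local Notation mon := (mon K).
Variables (rho : letter S -> {linear X -> X}) (x0 : X).
Hypothesis rhoK : forall c, cancel (rho (linv c)) (rho c).
Implicit Types (f g : A) (u w : freegroup S).

Local Notation action w := (act rho (fgword w)).

Lemma action_linear w : linear (action w).
Proof.
move=> a x y; elim: (fgword w) x y => //= c s IHs x y.
by rewrite linearP IHs.
Qed.

Lemma evaluation_exists :
  exists2 ev : A -> X, linear ev & forall w, ev (mon w) = action w x0.
Proof.
pose ev f := \sum_(w <- gasupp f) gacoef w f *: action w x0.
have evE (d : {fset freegroup S}) f : (gasupp f `<=` d)%fset ->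
    ev f = \sum_(w <- d) gacoef w f *: action w x0.
  move=> fd; apply: big_fset_incl => // w _ /gacoef_notin->.
  by rewrite scale0r.
exists ev => [a f g|w].
  set h := a *: f + g.
  pose d := (gasupp h `|` (gasupp f `|` gasupp g))%fset; rewrite !(@evE d); first last.
  - exact: fsubsetUl.
  - by rewrite fsubsetU // fsubsetUl orbT.
  - by rewrite fsubsetU // fsubsetUr orbT.
  rewrite scaler_sumr -big_split /=; apply: eq_bigr => w _.
  by rewrite raddfD /= gacoefZ scalerDl scalerA.
rewrite (@evE [fset w]%fset); last exact: msuppU_le.
by rewrite big_seq_fset1 gacoef_mon eqxx scale1r.
Qed.

Variable ev : A -> X.
Hypothesis ev_linear : linear ev.
Hypothesis ev_mon : forall w, ev (mon w) = action w x0.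

Lemma ev_mul f u : ev (f * mon u) = action u (ev f).
Proof.
pose D : set A := [set f | ev (f * mon u) = action u (ev f)].
suff : D f by [].
have [ev0 evD evZ] := linear_facts ev_linear.
have [act0 actD actZ] := linear_facts (action_linear u).
apply: subspace_supp => [|w _]; rewrite /D /=.
  split=> [|f1 f2|a f1] /=.
  - by rewrite mul0r ev0 act0.
  - by move=> D1 D2; rewrite mulrDl [LHS]evD [in RHS]evD actD; apply: f_equal2.
  - by move=> D1; rewrite -scalerAl [LHS]evZ [in RHS]evZ actZ; apply: f_equal2.
by rewrite monM !ev_mon (act_mul rhoK).
Qed.

(** The kernel is the annihilator of [x0]: by [ev_mul], right multiplication by a word becomes the
    action of that word. *)
Lemma ev_kernel_ideal : right_ideal [set f | ev f = 0].
Proof.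
have [ev0 evD evZ] := linear_facts ev_linear.
split=> [|f g f0 g0|f g f0] /=; first exact: ev0.
  by rewrite evD f0 g0 addr0.
pose D : set A := [set g | ev (f * g) = 0].
suff : D g by [].
apply: subspace_supp => [|u _]; rewrite /D /=.
  split=> [|g1 g2 D1 D2|a g1 D1] /=; first by rewrite mulr0 ev0.
    by rewrite mulrDr evD -[RHS]addr0; exact: (f_equal2 _ D1 D2).
  by rewrite -scalerAr evZ -[RHS](scaler0 _ a); apply: f_equal2.
have [act0 _ _] := linear_facts (action_linear u).
by rewrite ev_mul f0 act0.
Qed.

End Evaluation.

(** * Partial actions by injective linear maps *)

Section PartialAction.
Variables (K : fieldType) (S : finType).
Local Notation F := (freegroup S).
Local Notation A := (grpalg K F).
Local Notation mon := (mon K).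
Variable le : rel F.
Hypothesis le_wo : well_order le.
Implicit Types (f g x y : A) (w : F) (D : set A).

(** The words that are not congruent modulo [D] to a combination of smaller words span a complement
    of [D]: induction along [le] gives the sum, and the head term shows that the intersection is
    zero. The projection subtracts the component in this complement. *)
Lemma projection_exists D : subspace D ->
  exists p : {linear A -> A}, (forall x, D (p x)) /\ forall x, D x -> p x = x.
Proof.
move=> sD.
pose N : set F := [set w |
  ~ exists2 g, supported [set u | prec le u w] g & D (mon w - g)].
have sN := supported_subspace K N.
have span x : exists n, supported N n /\ D (x - n).
  pose P : set A := [set x | exists n, supported N n /\ D (x - n)].
  have sP : subspace P.
    split=> [|x1 x2 [n1 [N1 D1]] [n2 [N2 D2]]|a x1 [n1 [N1 D1]]].
    - exists 0; split; first exact: subspace0 sN.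
      by rewrite subr0; exact: subspace0 sD.
    - exists (n1 + n2); split; first exact: subspaceD sN N1 N2.
      by rewrite opprD addrACA; exact: subspaceD sD D1 D2.
    - exists (a *: n1); split; first exact: (subspaceZ a sN N1).
      by rewrite -scalerBr; exact: (subspaceZ a sD D1).
  suff : P x by [].
  apply: subspace_supp => // w _.
  elim/(prec_ind le_wo): w => w IHw.
  have [Nw|] := pselect (N w).
    exists (mon w); split; first exact: supported_mon.
    by rewrite subrr; exact: subspace0 sD.
  move=> /contrapT[g gw Dg].
  have [n [Nn Dn]] : P g.
    by apply: subspace_supp => // u gu; apply/IHw/(supported_in gw gu).
  exists n; split => //.
  by rewrite -(subrK g (mon w)) -addrA; exact: subspaceD sD Dg Dn.
have uniq n : supported N n -> D n -> n = 0.
  move=> Nn Dn; apply/eqP/negPn/negP => n0.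
  have [hn _] := HTP le_wo n0; case: (supported_in Nn hn).
  have [g gN Dg] := head_reduces le_wo sD Nn Dn n0; exists g => //.
  by apply: supportedS gN => u [].
have [nf nfP] := choice span.
have [|p pE] := @linear_bundle _ _ _ (fun x => x - nf x).
  move=> a x y; apply/eqP; rewrite -subr_eq0; apply/eqP.
  rewrite scalerBr addrACA -opprD opprB addrAC addrCA subrr addr0.
  have [Nx Dx] := nfP x; have [Ny Dy] := nfP y; have [Nz Dz] := nfP (a *: x + y).
  apply: uniq; first exact: subspaceB sN (subspaceD sN (subspaceZ a sN Nx) Ny) Nz.
  have -> : a *: nf x + nf y - nf (a *: x + y) =
            (a *: x + y - nf (a *: x + y)) - (a *: (x - nf x) + (y - nf y)).
    rewrite scalerBr addrACA -opprD opprB [RHS]addrC addrA.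
    by rewrite -(addrA _ (- _)) addNr addr0.
  exact: subspaceB sD Dz (subspaceD sD (subspaceZ a sD Dx) Dy).
exists p; split=> x; rewrite pE; first by case: (nfP x).
move=> Dx; have [Nx Dnx] := nfP x; rewrite (uniq (nf x)) ?subr0 //.
by rewrite -(subKr x (nf x)); exact: subspaceB sD Dx Dnx.
Qed.

(** [Gam c] is the graph of a linear map between subspaces; [GamV] and [Gam_fun] together make it
    injective. *)
Variable Gam : letter S -> A -> A -> Prop.
Hypothesis Gam0 : forall c, Gam c 0 0.
Hypothesis GamD : forall c x1 x2 y1 y2,
  Gam c x1 y1 -> Gam c x2 y2 -> Gam c (x1 + x2) (y1 + y2).
Hypothesis GamZ : forall c a x y, Gam c x y -> Gam c (a *: x) (a *: y).
Hypothesis GamV : forall c x y, Gam c x y -> Gam (linv c) y x.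
Hypothesis Gam_fun : forall c y, Gam c 0 y -> y = 0.

(** Each partial map is composed with a projection onto its domain and then dilated to an
    automorphism. Evaluation at the copy of [1] in the origin gives [ev]; the last clause says that
    the true action agrees with the partial maps. *)
Lemma partial_action_extends : exists (X : lmodType K) (ev iota : A -> X),
  [/\ linear ev, linear iota /\ injective iota, right_ideal [set g | ev g = 0], ev 1 = iota 1 &
      forall c x y w, Gam c x y -> ev (mon w) = iota x ->
        ev (mon (w * letter_elt c)%g) = iota y].
Proof.
have Gam_uniq c x y1 y2 : Gam c x y1 -> Gam c x y2 -> y1 = y2.
  move=> G1 G2; apply/eqP; rewrite -subr_eq0; apply/eqP/(@Gam_fun c).
  by rewrite -{1}(subrr x) -scaleN1r -[- y2]scaleN1r; apply/GamD/GamZ.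
pose dom c : set A := [set x | exists y, Gam c x y].
have [c|pi piP] := @choice _ {linear A -> A} (fun c p =>
    (forall x, dom c (p x)) /\ forall x, dom c x -> p x = x).
  apply: projection_exists; split=> [|x1 x2 [y1 G1] [y2 G2]|a x [y G]].
  - by exists 0; apply: Gam0.
  - by exists (y1 + y2); apply: GamD.
  - by exists (a *: y); apply: GamZ.
have [c|tau tauP] := @choice _ {linear A -> A} (fun c t =>
    forall x, Gam c (pi c x) (t x)).
  have [t tP] := choice (piP c).1.
  have [|t' t'E] := @linear_bundle _ _ _ t; last by exists t' => x; rewrite t'E.
  move=> a x y; apply: (@Gam_uniq c (pi c (a *: x + y))) => //.
  by rewrite linearP; apply: GamD => //; apply: GamZ.
have piK c x : pi c (pi c x) = pi c x by apply: (piP c).2; apply: (piP c).1.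
have tau_pi c x : tau c (pi c x) = tau c x.
  by apply: (Gam_uniq _ _ _ _ (tauP c (pi c x))); rewrite piK.
have pi_tau c x : pi (linv c) (tau c x) = tau c x.
  by apply: (piP _).2; exists (pi c x); apply: GamV.
have tauK c x : tau (linv c) (tau c x) = pi c x.
  by apply: (Gam_uniq _ _ _ _ (tauP _ _)); rewrite pi_tau; apply: GamV.
pose X : lmodType K := hotel A.
have [rho rhoP] := @choice _ {linear X -> X} (fun c (r : {linear X -> X}) =>
  r =1 dilate pi tau c) (fun c => linear_bundle (dilate_linear pi tau c)).
have rhoK c : cancel (rho (linv c)) (rho c).
  by move=> v; rewrite !rhoP dilateK.
pose iota : A -> X := @at_origin K A.
have [ev ev_lin evE] := evaluation_exists rho (iota 1).
exists X, ev, iota; split=> //.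
- by split=> [|x y /(congr1 (@^~ None))//]; apply: at_origin_linear.
- exact: (ev_kernel_ideal rhoK ev_lin evE).
- by rewrite -[in ev _](mon1 K) evE.
move=> c x y w Gxy evw.
have pix : pi c x = x by apply: (piP c).2; exists y.
rewrite -monM (ev_mul rhoK ev_lin evE) /= evw rhoP dilate_origin //.
by congr at_origin; apply: (@Gam_uniq c x) => //; rewrite -{1}pix.
Qed.

End PartialAction.

(** * Adjoining an exposure-extending element *)

Section Extension.
Variables (K : fieldType) (S : finType).
Local Notation F := (freegroup S).
Local Notation A := (grpalg K F).
Local Notation mon := (mon K).
Variable le : rel F.
Hypothesis le_exp : exposure_order le.
Let le_wo : well_order le := le_exp.1.
Variables (I : set A) (f : A).
Hypotheses (I_id : right_ideal I) (I_proper : I <> setT).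
Hypotheses (f_nonscalar : nonscalar f) (f_monic : is_monic le f).
Let T := min_transversal le I.
Let h := HT le f.
Hypotheses (f_supp : supported T f) (f_second : prec le h (HT le (second le I f))).
(* [X] will be the exposure basis of [I]. *)
Variable X : set A.
Hypothesis X_gen : right_ideal_gen X = I.
Hypothesis X_below : forall r, X r -> exists w g,
  [/\ r = mon w - g, prec le w h, boundary T w & supported (below le T w) g].
Implicit Types (g x y : A) (c : letter S) (u v w p : F).

Local Notation V := (supported (K := K) (below le T h)).

Let T_greedy : greedy le I T := min_transversal_greedy le_exp I_id.
Let sI : subspace I := right_ideal_subspace I_id.
Let sV : subspace V := supported_subspace K (below le T h).
Let sT : subspace (supported T) := supported_subspace K T.

Lemma normal_formP g :
  supported T (normal_form le I g) /\ I (normal_form le I g - g).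
Proof.
have [n nT In] := greedy_span I_id T_greedy g.
suff /xgetPex : exists n, supported T n /\ I (n - g) by apply.
by exists n; split=> //; rewrite -opprB; exact: (subspaceN sI In).
Qed.

(** Otherwise the empty word is a boundary word with no smaller words to reduce to, which puts [1]
    into [I]. *)
Lemma min_transversal1 : T 1%g.
Proof.
apply: contrapT => nT; apply: I_proper; apply: right_ideal_1 => //.
have [|g gT Ig] := greedy_boundary T_greedy (w := 1%g).
  split=> // u; rewrite /is_prefix prefixs0 => /eqP u1 /eqP[].
  exact: val_inj.
move: Ig; rewrite (supported0 _ gT) ?subr0 // => u [_].
by rewrite /= => /(precNle le_wo); rewrite (prefix_le le_exp (is_prefix1 _)).
Qed.

(** The identity is the least word, so an element with this head term is a scalar. *)
Lemma HT_neq1 : h <> 1%g.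
Proof.
move=> h1; apply: f_nonscalar; exists (gacoef 1%g f).
have [f0 _] := f_monic; have [_ hmax] := HTP le_wo f0.
rewrite -mon1; apply/gaP => w; rewrite gacoefZ gacoef_mon.
have [->|nw1] := eqVneq 1%g w; first by rewrite mulr1.
rewrite mulr0; apply/eqP/negPn/negP => /hmax lew.
case/negP: nw1; apply/eqP/(wo_anti le_wo); first exact: (prefix_le le_exp (is_prefix1 w)).
by rewrite -/h h1 in lew.
Qed.

Lemma word_cases w : w = 1%g \/ exists p c,
  [/\ w = (p * letter_elt c)%g, is_prefix p w, p != w,
      (size (fgword p) < size (fgword w))%N & last_letter w = letter_elt c].
Proof.
case E : _ / (lastP (fgword w)) => [|s c]; first by left; apply: val_inj.
right; have [p [pE wpc pw npw]] := fg_rcons E; exists p, c; split=> //.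
  by rewrite size_rcons pE.
by rewrite /last_letter E rev_rcons.
Qed.

(* [partial_step b c x y] holds when [x] times the letter [c] is [y] modulo the
   new relation [f], both being supported below [h]. Besides [I], only the two
   consequences [f] (read at [c = b], the last letter of [h]) and [f b^-1]
   (read at [c = b^-1]) are allowed, which keeps the relation functional:
   [f] has head [h], and [f b^-1] reduces to the second, whose head exceeds [h]. *)
Let defect b c : A :=
  if c == b then f else if c == linv b then f * mon (letter_elt c) else 0.

Let partial_step b c x y : Prop :=
  [/\ V x, V y & exists a : K, I (x * mon (letter_elt c) - y - a *: defect b c)].

(** Multiplying by the inverse letter turns the defect at [c] into the defect at [linv c]; the sign
    of [a] changes. *)
Lemma partial_stepV b c x y : partial_step b c x y -> partial_step b (linv c) y x.
Proof.
case=> Vx Vy [a Ia]; split=> //; exists (- a).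
have defV : defect b c * mon (letter_elt (linv c)) = defect b (linv c).
  rewrite /defect; have [->|ncb] := eqVneq c b.
    by rewrite (negbTE (linv_neq b)) eqxx.
  have -> : (linv c == linv b) = false.
    by rewrite (inj_eq (can_inj (@linvK S))); apply: negbTE.
  rewrite -[linv c == b](inj_eq (can_inj (@linvK S))) linvK.
  by case: eqVneq => [_|_]; rewrite ?mul0r // -letter_eltV monMK.
have [_ _ IM] := I_id; have := IM _ (mon (letter_elt (linv c))) Ia.
rewrite !mulrBl -scalerAl defV -letter_eltV monMK => Ic.
by have := subspaceN sI Ic; rewrite scaleNr opprK opprB opprB addrC.
Qed.

(** At [c = b], comparing coefficients at [h] gives [a = 0], as [y] lies below [h]. At [c = linv b],
    a nonzero [a] would make the normal form of [f] times that letter a multiple of [y], although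
    its head exceeds [h]. In all remaining cases [y] is in [I] and supported on [T]. *)
Lemma partial_step_functional b c y : HTT le f = letter_elt b -> partial_step b c 0 y -> y = 0.
Proof.
move=> bE [_ Vy [a]]; rewrite mul0r sub0r -opprD => /(subspaceN sI).
rewrite opprK => Ia.
have yT : supported T y by apply: supportedS Vy => u [].
have [f0 fh] := f_monic.
have yh : gacoef h y = 0.
  by apply/eqP/negPn/negP => /(supported_in Vy)[_]; rewrite /= prec_irr.
move: Ia; rewrite /defect; case: eqVneq => [_|_].
  move=> /(greedy_free le_exp I_id T_greedy (subspaceD sT yT (subspaceZ a sT f_supp))) yaf.
  move: (congr1 (gacoef h) yaf); rewrite raddfD /= gacoefZ yh add0r raddf0.
  by rewrite [gacoef h f]fh mulr1 => a0; rewrite a0 scale0r addr0 in yaf.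
case: eqVneq => [->|_]; last first.
  by rewrite scaler0 addr0; apply: (greedy_free le_exp I_id T_greedy).
move=> Ia; set f' := f * mon (letter_elt (linv b)) in Ia.
have [nT In] := normal_formP f'; set n := normal_form le I f' in nT In.
have yan : y + a *: n = 0.
  apply: (greedy_free le_exp I_id T_greedy); first exact: subspaceD sT yT (subspaceZ a sT nT).
  have := subspaceD sI Ia (subspaceZ a sI In).
  by rewrite scalerBr addrACA subrr addr0.
have [a0|a0] := eqVneq a 0; first by rewrite a0 scale0r addr0 in yan.
move: f_second; rewrite /second bE letter_eltV -/(mon _) -/f' -/n /monic_multiple.
(* If the normal form vanished, the second would be [0], whose head term is by default the identity;
   this cannot lie above [h]. *)
have [->|n0] := eqVneq n 0.
  by rewrite scaler0 HT0 => /(precNle le_wo); rewrite (prefix_le le_exp (is_prefix1 _)).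
have [hn _] := HTP le_wo n0; rewrite HTZ ?invr_eq0 // => hn_lt.
have nE : n = - a^-1 *: y.
  rewrite (eqP (_ : y == - (a *: n))) -?addr_eq0 ?yan //.
  by rewrite scalerN scaleNr opprK scalerA mulVf // scale1r.
have Vn : V n by rewrite nE; exact: subspaceZ _ sV Vy.
have [_ /= /(precNle le_wo)] := supported_in Vn hn.
by rewrite (prec_le hn_lt).
Qed.

Lemma extension_free g : V g -> right_ideal_gen (I `|` [set f]) g -> g = 0.
Proof.
have [f0 fh] := f_monic; have [hf hmax] := HTP le_wo f0.
have [/HT_neq1//|[p [b [hpb ph nph _ bE]]]] := word_cases h.
have T_closed := greedy_closed T_greedy.
have prefV u v : is_prefix u v -> T v -> prec le v h -> V (mon u).
  move=> uv Tv vh; apply: supported_mon; split; first exact: T_closed Tv.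
  by apply: (le_prec_trans le_wo) vh; apply: (prefix_le le_exp).
have [|||||E [ev [iota [ev_lin [iota_lin iota_inj] ker_id ev1 evM]]]] :=
    @partial_action_extends K S le le_wo (partial_step b).
- move=> c; split; try exact: subspace0 sV.
  by exists 0; rewrite mul0r scale0r !subr0; exact: subspace0 sI.
- move=> c x1 x2 y1 y2 [Vx1 Vy1 [a1 I1]] [Vx2 Vy2 [a2 I2]].
  split; [exact: subspaceD sV Vx1 Vx2|exact: subspaceD sV Vy1 Vy2|].
  exists (a1 + a2); rewrite mulrDl scalerDl 2!opprD.
  have := subspaceD sI I1 I2; rewrite (addrACA (x1 * _ - y1)).
  by rewrite (addrACA (x1 * _)).
- move=> c a x y [Vx Vy [a1 I1]].
  split; [exact: (subspaceZ a sV Vx)|exact: (subspaceZ a sV Vy)|].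
  exists (a * a1); rewrite -scalerAl -scalerA -!scalerBr.
  exact: (subspaceZ a sI I1).
- by move=> c x y; apply: partial_stepV.
- by move=> c y; apply: partial_step_functional.
have [ev0 evD evZ] := linear_facts ev_lin.
have [iota0 iotaD iotaZ] := linear_facts iota_lin.
have evB x y : ev (x - y) = ev x - ev y by rewrite evD -[- y in LHS]scaleN1r evZ scaleN1r.
(* Induction on the length: along the prefixes of [w], which are in [T], each letter is a partial
   step with [a = 0]. *)
have ev_word w : T w -> prec le w h -> ev (mon w) = iota (mon w).
  move: {2}(size _).+1 (ltnSn (size (fgword w))) => n.
  elim: n w => [w|n IHn w wn Tw wh]; first by rewrite ltn0.
  have [->//|[q [c [wqc qw nqw sqw _]]]] := word_cases w.
  rewrite {1}wqc; apply: (evM _ (mon q)); last first.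
    apply: IHn; first exact: leq_trans sqw _.
      exact: T_closed Tw.
    by apply: (le_prec_trans le_wo) wh; apply: (prefix_le le_exp).
  split; [exact: prefV Tw wh|by apply: supported_mon|].
  by exists 0; rewrite monM -wqc subrr scale0r subr0; exact: subspace0 sI.
have evV g' : V g' -> ev g' = iota g'.
  move=> Vg; pose D : set A := [set x | ev x = iota x].
  suff : D g' by [].
  apply: subspace_supp => [|u /(supported_in Vg)[]]; last exact: ev_word.
  split=> [|x1 x2 D1 D2|a x1 D1]; rewrite /D /=; first by rewrite ev0.
    by rewrite evD iotaD D1 D2.
  by rewrite evZ iotaZ D1.
have ev_step c q w g' : w = (q * letter_elt c)%g -> partial_step b c (mon q) g' ->
    V (mon q) -> ev (mon w) = ev g'.
  move=> -> Gqg Vq; rewrite [RHS]evV; last by case: Gqg.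
  by apply: (evM _ (mon q)); rewrite ?evV.
move=> Vg I'g; suff : ev g = 0.
  by rewrite evV // -iota0 => /iota_inj.
apply: (right_ideal_gen_sub ker_id) I'g => x [|-> /=].
  (* Elements of [I] may involve words above [h], where [ev] is not controlled. The generators in
     [X] only involve words below [h]. *)
  rewrite -{1}X_gen; apply: right_ideal_gen_sub => // r Xr.
  have [w [g' [rE wh [bw nTw] g'w]]] := X_below Xr.
  have [w1|[q [c [wqc qw nqw sqw _]]]] := word_cases w.
    by case: nTw; rewrite w1; apply: min_transversal1.
  have Vg' : V g'.
    by apply: supportedS g'w => u [Tu uw]; split=> //; apply: (prec_trans le_wo) wh.
  have Vq : V (mon q).
    apply: prefV (bw q qw nqw) _; first exact: is_prefix_refl.
    by apply: (prec_trans le_wo) wh; apply: (prefix_prec le_exp).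
  rewrite /= rE evB (ev_step c q w g') ?subrr //; split=> //.
  exists 0; rewrite monM -wqc scale0r subr0 -X_gen -rE.
  exact: right_ideal_gen_in.
have Vhf : V (mon h - f).
  apply/supportedP => u; rewrite raddfB /= gacoef_mon.
  have [<-|nhu] := eqVneq h u; first by rewrite [gacoef h f]fh subrr eqxx.
  rewrite sub0r oppr_eq0 => fu; split; first exact: supported_in fu.
  by rewrite /= /prec eq_sym nhu hmax.
have Vp : V (mon p).
  apply: supported_mon; split; last exact: (prefix_prec le_exp).
  exact: T_closed ph (supported_in f_supp hf).
rewrite -(subKr (mon h) f) evB (ev_step b p h (mon h - f)) ?subrr //.
(* Here [p b - (h - f) = f] is exactly the defect at the letter [b]. *)
split=> //; exists 1.
by rewrite monM -hpb subKr scale1r /defect eqxx subrr; exact: subspace0 sI.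
Qed.

End Extension.

(** * The exposure process *)

Section Exposed.
Variables (K : fieldType) (S : finType).
Local Notation F := (freegroup S).
Local Notation A := (grpalg K F).
Local Notation mon := (mon K).
Variable le : rel F.
Hypothesis le_exp : exposure_order le.
Let le_wo : well_order le := le_exp.1.
Implicit Types (f g x y : A) (u v w : F) (I J : set A) (T : set F).

Lemma suppE f u : supp f u = (gacoef u f != 0).
Proof. by rewrite gacoef_neq0. Qed.

Lemma HT_lead T w g : supported (below le T w) g ->
  HT le (mon w - g) = w /\ is_monic le (mon w - g).
Proof.
move=> gT.
have gw : gacoef w (mon w - g) = 1.
  rewrite raddfB /= gacoef_mon eqxx (_ : gacoef w g = 0) ?subr0 //.
  by apply/eqP/negPn/negP => /(supported_in gT)[_]; rewrite /= prec_irr.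
have hE : HT le (mon w - g) = w.
  apply: (HT_eq le_wo); first by rewrite gw oner_eq0.
  move=> v; rewrite raddfB /= gacoef_mon.
  have [<- _|_] := eqVneq w v; first exact: wo_refl.
  by rewrite sub0r oppr_eq0 => /(supported_in gT)[_ /prec_le].
split=> //; split; last by rewrite /HC hE.
by apply: contra_eq_neq gw => ->; rewrite raddf0 eq_sym oner_neq0.
Qed.

Lemma HT_lead_neq0 T w g : supported (below le T w) g -> mon w - g <> 0.
Proof. by move=> /HT_lead[_ [/eqP]]. Qed.

(** A competitor cannot have a smaller head than [g]. If the heads agree, its difference from [g] is
    supported below them and vanishes; if its head is larger, that head decides the comparison of
    supports. *)
Lemma exposed_next_min I J g : right_ideal I -> I g -> is_monic le g ->
    supported (min_transversal le J) g ->
    (forall x, supported (below le (min_transversal le J) (HT le g)) x ->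
       I x -> x = 0) ->
  exposed_next le I J g.
Proof.
move=> I_id Ig g_monic gT I_free; split=> // x [Ix [x0 x1] xT] xg.
have [g0 g1] := g_monic; have [hg gmax] := HTP le_wo g0.
have [hx xmax] := HTP le_wo x0.
have sI := right_ideal_subspace I_id.
have sT := supported_subspace K (min_transversal le J).
have [gx|xg_lt] := leP_prec le_wo (HT le g) (HT le x); last first.
  case/eqP: x0; apply: I_free => //; apply/supportedP => u xu.
  split; first exact: supported_in xu.
  by apply: (le_prec_trans le_wo) xg_lt; apply: xmax.
case: (le_eqVprec gx) => [hE|gx_lt].
  case: xg; suff -> : x = g by [].
  apply/eqP; rewrite -subr_eq0; apply/eqP/I_free; last exact: (subspaceB sI Ix Ig).
  apply/supportedP => u xgu; split.
    exact: supported_in (subspaceB sT xT gT) xgu.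
  have nu : u != HT le g.
    apply: contraNneq xgu => ->; rewrite raddfB /= {1}hE.
    by rewrite [gacoef _ x]x1 [gacoef _ g]g1 subrr.
  rewrite /= /prec nu; move: xgu; rewrite raddfB /=.
  have [->|/xmax] := eqVneq (gacoef u x) 0; last by rewrite hE.
  by rewrite sub0r oppr_eq0 => /gmax.
exists (HT le x); last by rewrite suppE.
split.
  apply/symdiffP; right; rewrite !suppE; split=> //.
  by move=> /gmax; apply/negP; apply: precNle.
move=> u /symdiffP; rewrite !suppE => -[[/gmax gu _]|[/xmax]//].
exact: (wo_trans le_wo) gx.
Qed.

(** The supports agree, since otherwise each would precede the other. If the elements differed, the
    monic multiple of their difference would be a candidate whose support lies in that of [g1] and
    misses its head, against minimality. *)
Lemma exposed_next_uniq I J g1 g2 : right_ideal I ->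
  exposed_next le I J g1 -> exposed_next le I J g2 -> g1 = g2.
Proof.
move=> I_id [[I1 [n1 m1] T1] min1] [[I2 [n2 m2] T2] min2].
have sI := right_ideal_subspace I_id.
have sT := supported_subspace K (min_transversal le J).
have supp12 : supp g1 = supp g2.
  apply: contrapT => n12.
  have [u [u12 umax] u2] := min1 _ (And3 I2 (conj n2 m2) T2) (fun e => n12 (esym e)).
  have [v [v12 vmax] v1] := min2 _ (And3 I1 (conj n1 m1) T1) n12.
  have vu : v = u.
    apply: (wo_anti le_wo); [apply: umax|apply: vmax].
      by apply/symdiffP; case/symdiffP: v12; [right|left].
    by apply/symdiffP; case/symdiffP: u12; [right|left].
  by case/symdiffP: u12 => -[//]; rewrite -vu.
have coefE u : (gacoef u g1 != 0) = (gacoef u g2 != 0).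
  by apply/idP/idP; rewrite -!suppE supp12.
have [h1 max1] := HTP le_wo n1; have [h2 max2] := HTP le_wo n2.
have hE : HT le g1 = HT le g2.
  by apply: (HT_eq le_wo) => [|v]; rewrite coefE // => /max2.
apply/eqP/negPn/negP => n12; rewrite -subr_eq0 in n12.
have [hd _] := HTP le_wo n12; set d := g1 - g2 in n12 hd.
pose k := (HC le d)^-1 *: d.
have a0 : (HC le d)^-1 != 0 by rewrite invr_eq0.
have kd u : (gacoef u k != 0) = (gacoef u d != 0).
  by rewrite gacoefZ mulf_eq0 negb_or a0.
have sub u : gacoef u d != 0 -> gacoef u g1 != 0.
  by apply: contraNN => /[dup]; rewrite /d raddfB /= => /[dup] + /eqP ->;
    rewrite -[_ == 0]negbK coefE negbK => /eqP->; rewrite subrr.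
have kh : gacoef (HT le g1) k = 0.
  apply/eqP; rewrite -[_ == 0]negbK kd negbK /d raddfB /= [gacoef _ g1]m1 hE.
  by rewrite [gacoef _ g2]m2 subrr.
have [||u [u12 _] ku] := min1 k.
- split; first exact: (subspaceZ _ sI (subspaceB sI I1 I2)).
    split; first by rewrite scaler_eq0 negb_or a0.
    by rewrite /HC (HTZ le_wo) // gacoefZ mulVf.
  exact: (subspaceZ _ sT (subspaceB sT T1 T2)).
- move=> kg; move: h1; rewrite -suppE -kg suppE kh eqxx //.
have ug : supp g1 u by rewrite suppE; apply: sub; rewrite -kd -suppE.
by case/symdiffP: u12 => -[].
Qed.

End Exposed.

(** * Exposing edge relations at boundary words *)

Section Coincidences.
Variables (K : fieldType) (S : finType).
Local Notation F := (freegroup S).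
Local Notation A := (grpalg K F).
Local Notation mon := (mon K).
Variable le : rel F.
Hypothesis le_exp : exposure_order le.
Let le_wo : well_order le := le_exp.1.
Variable I : set A.
Hypothesis I_id : right_ideal I.
Let T := min_transversal le I.
(** At a boundary word, [tail] is the normal form modulo [I]; elsewhere its value is arbitrary. *)
Variable tail : F -> A.
Hypothesis tailP : forall w, boundary T w ->
  supported (below le T w) (tail w) /\ I (mon w - tail w).
Implicit Types (f g x y : A) (u v w : F).

Let T_greedy : greedy le I T := min_transversal_greedy le_exp I_id.
Let sI : subspace I := right_ideal_subspace I_id.
Let sT : subspace (supported T) := supported_subspace K T.

Definition edge_relation w : A := mon w - tail w.

(* The generators of the exposure basis are the edge relations at boundary words
   that do not follow from those at smaller boundary words. *)
Definition relations_below w : set A :=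
  right_ideal_gen [set edge_relation u | u in [set u | boundary T u /\ prec le u w]].

Definition coincidence w : Prop :=
  boundary T w /\ ~ relations_below w (edge_relation w).

Lemma relations_below_sub w : relations_below w `<=` I.
Proof. by apply: right_ideal_gen_sub => // _ [u [/tailP[_ Iu] _] <-]. Qed.

(** Induction along [le]: the relation at a boundary word that is not a coincidence follows from
    smaller relations. *)
Lemma edge_relation_coincidence w : boundary T w ->
  right_ideal_gen [set edge_relation u | u in [set u | coincidence u /\ le u w]]
    (edge_relation w).
Proof.
elim/(prec_ind le_wo): w => w IHw bw.
have [Jw|nJw] := pselect (relations_below w (edge_relation w)); last first.
  by apply: right_ideal_gen_in; exists w => //; split=> //; apply: wo_refl.
apply: (right_ideal_gen_sub (right_ideal_gen_ideal _)) Jw => _ [u [bu uw] <-].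
apply: right_ideal_genS (IHw u uw bu) => _ [v [cv vu] <-].
by exists v => //; split=> //; apply: (wo_trans le_wo) vu (prec_le uw).
Qed.

Lemma relations_below_coincidence w : relations_below w =
  right_ideal_gen [set edge_relation u | u in [set u | coincidence u /\ prec le u w]].
Proof.
apply/seteqP; split.
  apply: (right_ideal_gen_sub (right_ideal_gen_ideal _)) => _ [u [bu uw] <-].
  apply: right_ideal_genS (edge_relation_coincidence bu) => _ [v [cv vu] <-].
  by exists v => //; split=> //; apply: (le_prec_trans le_wo) vu uw.
by apply: right_ideal_genS => _ [u [[bu _] uw] <-]; exists u.
Qed.

(** The coincidences reduce all boundary words, so an element of [I] is congruent modulo their ideal
    to one supported on [T]; that one is again in [I], hence zero. *)
Lemma coincidences_generate :
  right_ideal_gen [set edge_relation u | u in coincidence] = I.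
Proof.
apply/seteqP; split.
  by apply: right_ideal_gen_sub => // _ [u [/tailP[_ Iu] _] <-].
move=> f If; set J := right_ideal_gen _.
have J_id : right_ideal J := right_ideal_gen_ideal _.
have JI : J `<=` I by apply: right_ideal_gen_sub => // _ [u [/tailP[_ Iu] _] <-].
have [w bw|g gT Jg] := boundary_reduces_span (greedy_closed T_greedy) J_id _ f.
  exists (tail w); first by have [+ _] := tailP bw; apply: supportedS => u [].
  by apply: right_ideal_genS (edge_relation_coincidence bw) => _ [v [cv _] <-]; exists v.
suff g0 : g = 0 by rewrite g0 subr0 in Jg.
apply: (greedy_free le_exp I_id T_greedy) => //.
by rewrite -(subKr f g); exact: (subspaceB sI If (JI _ Jg)).
Qed.

(** Both transversals are greedy and can be compared word by word. A boundary word of [T] before [w]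
    reduces by its edge relation, which is in the smaller ideal; conversely, a reduction modulo the
    smaller ideal is one modulo [I]. *)
Lemma transversal_below w u : boundary T w -> prec le u w ->
  (min_transversal le (relations_below w) u <-> T u).
Proof.
move=> bw; set J := relations_below w; set TJ := min_transversal le J.
have J_id : right_ideal J := right_ideal_gen_ideal _.
have TJ_greedy : greedy le J TJ := min_transversal_greedy le_exp J_id.
elim/(prec_ind le_wo): u => u IHu uw.
have IH v : prec le v u -> (TJ v <-> T v).
  by move=> vu; apply: IHu => //; apply: (prec_trans le_wo) vu uw.
split=> [TJu|Tu]; apply: contrapT => nTu.
  have bu : boundary T u.
    split=> // v vu nvu; apply/IH; first exact: prefix_prec.
    exact: (greedy_closed TJ_greedy) TJu.
  have [tT It] := tailP bu; apply: (HT_lead_neq0 le_exp tT).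
  apply: (greedy_free le_exp J_id TJ_greedy).
    apply: (subspaceB (supported_subspace K TJ)); first exact: supported_mon.
    by apply: supportedS tT => v [Tv vu]; apply/IH.
  by apply: right_ideal_gen_in; exists u.
have [|g gT Jg] := greedy_boundary TJ_greedy (w := u).
  split=> // v vu nvu; apply/IH; first exact: prefix_prec.
  exact: (greedy_closed T_greedy) Tu.
apply: (HT_lead_neq0 le_exp gT); apply: (greedy_free le_exp I_id T_greedy).
  apply: (subspaceB sT); first exact: supported_mon.
  by apply: supportedS gT => v [TJv vu]; apply/IH.
exact: relations_below_sub Jg.
Qed.

(** Stated for [I2] so as to serve both [I] and the ideal enlarged by [f]: the candidates change,
    the relations exposed before do not. *)
Lemma coincidence_exposed I2 w : right_ideal I2 -> I `<=` I2 -> coincidence w ->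
    (forall x, supported (below le T w) x -> I2 x -> x = 0) ->
  exposed_next le I2 (relations_below w) (edge_relation w).
Proof.
move=> I2_id II2 [bw nJw] I2_free; have [tT It] := tailP bw.
have TJE u := @transversal_below w u bw.
have J_id : right_ideal (relations_below w) := right_ideal_gen_ideal _.
have TJ_greedy := min_transversal_greedy le_exp J_id.
set TJ := min_transversal le _ in TJE TJ_greedy.
(* Otherwise [w] would reduce modulo the earlier relations; the result would be [tail w] by
   uniqueness modulo [I], and the edge relation would follow from smaller ones. *)
have TJw : TJ w.
  apply: contrapT => nTJw.
  have [|g gT Jg] := greedy_boundary TJ_greedy (w := w).
    split=> // u uw nuw; apply/TJE; first exact: prefix_prec.
    exact: bw.1.
  apply: nJw; rewrite /edge_relation; suff <- : g = tail w by [].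
  apply/eqP; rewrite -subr_eq0; apply/eqP/(greedy_free le_exp I_id T_greedy).
    apply: (subspaceB sT); last by apply: supportedS tT => u [].
    by apply: supportedS gT => u [TJu uw]; apply/TJE.
  have := subspaceB sI It (relations_below_sub Jg).
  by rewrite opprB addrC addrA subrK addrC.
have [hE rm] := HT_lead le_exp tT.
apply: exposed_next_min => //; first exact: II2.
  apply: (subspaceB (supported_subspace K TJ)); first exact: supported_mon.
  by apply: supportedS tT => u [Tu uw]; apply/TJE.
rewrite hE => x xT; apply: I2_free.
by apply: supportedS xT => u [TJu uw]; split=> //; apply/TJE.
Qed.

(** The coincidences themselves serve as the ordinals of the process. *)
Definition coincidence_le (a b : {w | coincidence w}) : bool := le (sval a) (sval b).

Definition coincidence_family (a : {w | coincidence w}) : A := edge_relation (sval a).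

Lemma coincidence_le_wo : well_order coincidence_le.
Proof.
apply: antisymmetric_well_order.
  by move=> [u cu] [v cv] /andP[uv vu]; apply: eq_exist; apply: (wo_anti le_wo).
move=> B [[u cu] Bu].
have [|w [cw Bw] wmin] := wo_min le_wo
    (P := fun w => exists cw : coincidence w, exist _ w cw \in B).
  by exists u, cu.
by exists (exist _ w cw); split=> // -[v cv] Bv; apply: wmin; exists cv.
Qed.

Lemma coincidence_before a :
  exposed_before coincidence_le coincidence_family a = relations_below (sval a).
Proof.
rewrite relations_below_coincidence /exposed_before; congr right_ideal_gen.
apply/seteqP; split=> x.
  move=> [[u cu] [ua nua] <-]; exists u => //; split=> //.
  rewrite /prec; apply/andP; split=> //; apply/eqP => uE; apply: nua.
  by case: a uE ua => v cv /= uE _; apply: eq_exist.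
move=> [u [cu /andP[nua ua]] <-]; exists (exist _ u cu) => //; split=> // uE.
by move: nua; rewrite -uE eqxx.
Qed.

Lemma coincidence_range :
  range coincidence_family = [set edge_relation u | u in coincidence].
Proof.
apply/seteqP; split=> x; first by move=> [[u cu] _ <-]; exists u.
by move=> [u cu <-]; exists (exist _ u cu).
Qed.

Lemma coincidence_process :
  exposure_process le I coincidence_le coincidence_family.
Proof.
split; first exact: coincidence_le_wo.
- move=> [w [bw nJw]]; rewrite coincidence_before /= => JI; apply: nJw.
  by rewrite JI; have [] := tailP bw.
- move=> [w cw]; rewrite coincidence_before; apply: coincidence_exposed => //.
  move=> x xT Ix; apply: (greedy_free le_exp I_id T_greedy) => //.
  by apply: supportedS xT => u [].
- by rewrite coincidence_range coincidences_generate.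
Qed.

End Coincidences.

(** * Uniqueness of the process and adjunction of a last step *)

Section Processes.
Variables (K : fieldType) (S : finType).
Local Notation F := (freegroup S).
Local Notation A := (grpalg K F).
Variable le : rel F.
Hypothesis le_exp : exposure_order le.
Implicit Types (I : set A) (f : A).

(** Induction on [a]. The partner of [a] is the first [a'] whose element is not generated before
    [a]; the ideals before [a] and [a'] then agree and determine the exposed element. *)
Lemma exposure_process_unique I (W W' : Type) (leW : rel W) (leW' : rel W')
    (fam : W -> A) (fam' : W' -> A) :
    right_ideal I -> exposure_process le I leW fam ->
    exposure_process le I leW' fam' ->
  forall a, exists a', exposed_before leW fam a = exposed_before leW' fam' a' /\
    fam a = fam' a'.
Proof.
move=> I_id [wo neq next gen] [wo' neq' next' gen'].
have before_id a : right_ideal (exposed_before leW fam a).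
  exact: right_ideal_gen_ideal.
have before_id' a : right_ideal (exposed_before leW' fam' a).
  exact: right_ideal_gen_ideal.
have before_in a b : leW b a -> b <> a -> exposed_before leW fam a (fam b).
  by move=> ba nba; apply: right_ideal_gen_in; exists b.
have before_in' a b : leW' b a -> b <> a -> exposed_before leW' fam' a (fam' b).
  by move=> ba nba; apply: right_ideal_gen_in; exists b.
have before_sub a : exposed_before leW fam a `<=` I.
  by apply: right_ideal_gen_sub => // _ [b _ <-]; case: (next b) => -[].
apply: (wo_ind wo) => a IHa.
suff [a' aa'] : exists a', exposed_before leW fam a = exposed_before leW' fam' a'.
  exists a'; split=> //; apply: (exposed_next_uniq le_exp I_id) (next a) _.
  by rewrite aa'.
have [|a' na' a'min] :=
    wo_min wo' (P := fun a' => ~ exposed_before leW fam a (fam' a')).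
  apply: contrapT => nex; apply: (neq a); apply/seteqP; split=> //.
  rewrite -gen'; apply: right_ideal_gen_sub => // _ [b' _ <-].
  by apply: contrapT => nb'; apply: nex; exists b'.
have sub' : exposed_before leW' fam' a' `<=` exposed_before leW fam a.
  apply: right_ideal_gen_sub => // _ [b' [b'a' nb'a'] <-].
  apply: contrapT => /a'min a'b'; exact/nb'a'/(wo_anti wo').
exists a'; apply/seteqP; split=> //.
apply: right_ideal_gen_sub => // _ [b [ba nba] <-].
have [b' [bb' fb]] := IHa b ba nba.
have before_ba : exposed_before leW fam b `<=` exposed_before leW fam a.
  apply: right_ideal_gen_sub => // _ [c [cb ncb] <-].
  apply: before_in; first exact: (wo_trans wo) ba.
  by move=> ca; apply: ncb; apply: (wo_anti wo) => //; rewrite ca.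
(* The partner [b'] of an earlier [b] precedes [a']; otherwise the element at [a'] would already be
   generated before [a]. *)
rewrite fb; have [b'a'|a'b'] := wo_total wo' b' a'.
  apply: before_in' => // b'E; apply: na'.
  by rewrite -b'E -fb; apply: before_in.
have [b'E|nb'] := pselect (a' = b').
  by case: na'; rewrite b'E -fb; apply: before_in.
by case: na'; apply: before_ba; rewrite bb'; apply: before_in'.
Qed.

Lemma exposure_basisE I (W : Type) (leW : rel W) (fam : W -> A) :
  right_ideal I -> exposure_process le I leW fam ->
  exposure_basis le I = range fam.
Proof.
move=> I_id P; apply/seteqP; split=> [_ [W' [leW' [fam' [P' [a _ <-]]]]]|g fg].
  by have [b [_ ->]] := exposure_process_unique I_id P' P a; exists b.
by exists W, leW, fam.
Qed.

Lemma exposure_secondsE I (W : Type) (leW : rel W) (fam : W -> A) :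
  right_ideal I -> exposure_process le I leW fam ->
  exposure_seconds le I =
  range (fun a => second le (exposed_before leW fam a) (fam a)).
Proof.
move=> I_id P; apply/seteqP; split=> [_ [W' [leW' [fam' [P' [a ->]]]]]|_ [a _ <-]].
  by have [b [-> ->]] := exposure_process_unique I_id P' P a; exists b.
by exists W, leW, fam; split=> //; exists a.
Qed.

Section TopExtension.
Variables (W : Type) (leW : rel W) (fam : W -> A) (f : A).
Hypothesis leW_wo : well_order leW.

(** [None] is a new greatest index, at which [f] is exposed after all of [fam]. *)
Definition top_le (x y : option W) : bool :=
  match x, y with
  | Some a, Some b => leW a b
  | _, None => true
  | None, Some _ => false
  end.

Definition top_family (x : option W) : A := if x is Some a then fam a else f.

Lemma top_le_wo : well_order top_le.
Proof.
apply: antisymmetric_well_order.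
  move=> [a|] [b|] //= /andP[ab ba]; congr Some; exact: (wo_anti leW_wo).
move=> B [x Bx]; have [nex|exB] := pselect (exists a, Some a \in B).
  have [a Ba amin] := wo_min leW_wo nex.
  by exists (Some a); split=> // -[b|] //; apply: amin.
have noB a : Some a \in B -> False by move=> Ba; apply: exB; exists a.
case: x Bx => [a /noB//|BN]; exists None; split=> // -[b /noB|] //.
Qed.

Lemma top_range : range top_family = range fam `|` [set f].
Proof.
apply/seteqP; split=> [_ [[a|] _ <-]|_ [[a _ <-]|->]]; [by left; exists a|by right| |].
  by exists (Some a).
by exists None.
Qed.

Lemma top_before a :
  exposed_before top_le top_family (Some a) = exposed_before leW fam a.
Proof.
congr right_ideal_gen; apply/seteqP; split=> x.
  move=> [[b [ba nba] <-|[] //]]; exists b => //; split=> // ab.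
  by apply: nba; rewrite ab.
by move=> [b [ba nba] <-]; exists (Some b) => //; split=> // -[].
Qed.

Lemma top_before_None :
  exposed_before top_le top_family None = right_ideal_gen (range fam).
Proof.
congr right_ideal_gen; apply/seteqP; split=> x.
  by move=> [[b _ <-|[_ []]//]]; exists b.
by move=> [b _ <-]; exists (Some b).
Qed.

Lemma top_seconds J : right_ideal_gen (range fam) = J ->
  range (fun x => second le (exposed_before top_le top_family x) (top_family x)) =
  range (fun a => second le (exposed_before leW fam a) (fam a)) `|` [set second le J f].
Proof.
move=> gen; apply/seteqP; split=> [_ [[a|] _ <-]|_ [[a _ <-]|->]].
- left; exists a; first exact: I.
  by rewrite top_before.
- by right; rewrite /= top_before_None gen.
- exists (Some a); first exact: I.
  by rewrite top_before.
- exists None; first exact: I.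
  by rewrite top_before_None gen.
Qed.

End TopExtension.
End Processes.

Theorem theorem1p8 (K : fieldType) (S : finType) (le : rel (freegroup S))
    (I : set (grpalg K (freegroup S))) (f : grpalg K (freegroup S)) :
  exposure_order le ->
  right_ideal I -> I <> setT ->
  exposure_extending le I f ->
  let I' := right_ideal_gen (I `|` [set f]) in
  let s := second le I f in
  exposure_basis le I' = exposure_basis le I `|` [set f] /\
  groebner_basis le I' = groebner_basis le I `|` [set f; s].
Proof.
move=> le_exp I_id I_proper [f_nonscalar f_monic f_supp f_basis f_second] I' s.
have le_wo : well_order le := le_exp.1.
have I'_id : right_ideal I' := right_ideal_gen_ideal _.
have II' : I `<=` I' by move=> x Ix; apply: right_ideal_gen_in; left.
have I'f : I' f by apply: right_ideal_gen_in; right.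
set T := min_transversal le I in f_supp.
have T_greedy : greedy le I T := min_transversal_greedy le_exp I_id.
have [w|tail tailP] := @choice (freegroup S) (grpalg K (freegroup S))
    (fun w t => boundary T w -> supported (below le T w) t /\ I (mon K w - t)).
  have [/(greedy_boundary T_greedy)[t tT It]|nbw] := pselect (boundary T w).
    by exists t.
  by exists 0.
have P := coincidence_process le_exp I_id tailP.
set fam := @coincidence_family _ _ _ _ _ in P; set leW := @coincidence_le _ _ _ _ _ in P.
have [leW_wo before_neq before_next gen] := P.
have basisE := exposure_basisE le_exp I_id P.
(* The coincidences are the head terms of the exposure basis, so the hypothesis on [f] puts them
   before its head term. *)
have coincidence_lt (w : {w | coincidence le I tail w}) : prec le (sval w) (HT le f).
  have [tT _] := tailP _ (proj2_sig w).1.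
  have [<- _] := HT_lead le_exp tT; apply: f_basis.
  by rewrite basisE; exists w.
have free x : supported (below le T (HT le f)) x -> I' x -> x = 0.
  apply: (extension_free le_exp I_id I_proper f_nonscalar f_monic f_supp f_second gen).
  move=> _ [w _ <-]; exists (sval w), (tail (sval w)).
  have bw := (proj2_sig w).1; have [tT _] := tailP _ bw.
  by split=> //; apply: coincidence_lt.
have f_neq0 : f <> 0 by case: f_monic => /eqP.
have nIf : ~ I f by move=> If; apply: f_neq0; apply: (greedy_free le_exp I_id T_greedy).
have P' : exposure_process le I' (top_le leW) (top_family fam f).
  split; first exact: top_le_wo.
  (* No stage is [I'] already: the ideals generated so far stay inside [I], which misses [f]. *)
  - move=> [a|]; rewrite ?top_before ?top_before_None ?gen => I'E; apply: nIf;
      last by rewrite I'E.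
    move: I'f; rewrite -I'E; apply: right_ideal_gen_sub => // _ [b _ <-].
    by case: (before_next b) => -[].
  (* The candidates now range over [I'], but [free] leaves no nonzero one below the head of [f]: the
     old elements stay minimal, and [f] is minimal at the last step. *)
  - move=> [a|]; rewrite ?top_before ?top_before_None ?gen /=; last first.
      exact: exposed_next_min.
    rewrite coincidence_before //; apply: (coincidence_exposed le_exp I_id tailP) => //.
      exact: proj2_sig a.
    move=> x xT; apply: free; apply: supportedS xT => u [Tu ua]; split=> //.
    exact: (prec_trans le_wo) ua (coincidence_lt a).
  - rewrite top_range; apply/seteqP; split.
      apply: right_ideal_gen_sub => // x [fx|->//].
      by apply: II'; rewrite -gen; apply: right_ideal_gen_in.
    apply: right_ideal_gen_sub; first exact: right_ideal_gen_ideal.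
    move=> x [Ix|->]; last by apply: right_ideal_gen_in; right.
    have /(_ x Ix) : I `<=` right_ideal_gen (range fam) by rewrite gen.
    by apply: right_ideal_genS => y; left.
have basisE' : exposure_basis le I' = exposure_basis le I `|` [set f].
  by rewrite (exposure_basisE le_exp I'_id P') top_range basisE.
have secondsE' : exposure_seconds le I' = exposure_seconds le I `|` [set s].
  rewrite (exposure_secondsE le_exp I'_id P') (exposure_secondsE le_exp I_id P).
  exact: top_seconds.
(* This excludes the separate convention for the whole algebra in [groebner_basis]. The word [1] is
   in [T] and below the head of [f], hence not in [I']. *)
have I'_proper : I' <> setT.
  move=> I'T; have : mon K (1%g : freegroup S) = 0.
    apply: free; last by rewrite I'T.
    apply: supported_mon; split; first exact: (min_transversal1 le_exp I_id I_proper).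
    apply: (prefix_prec le_exp); first exact: is_prefix1.
    by apply/eqP => /esym; apply: (HT_neq1 le_exp f_nonscalar f_monic).
  by move/eqP; rewrite mon1 oner_eq0.
split=> //; rewrite /groebner_basis basisE' secondsE'.
apply/seteqP; split=> x.
  move=> [[]//|[_ [[Bx|->]|[Sx|->]]]].
  - by left; right; split=> //; left.
  - by right; left.
  - by left; right; split=> //; right.
  - by right; right.
move=> [[[]//|[_ [Bx|Sx]]]|[->|->]]; right; split=> //.
- by left; left.
- by right; left.
- by left; right.
- by right; right.
Qed.
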